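(* Let $a^*(\tau):=\Big[32(1+\tau\sqrt{\Delta})\sqrt{1+\frac{1}{8\kappa}\min\{\frac{1}{\sqrt\Delta},\tau\}}\Big]^{-1}$. For every constant $K>0$ there is a constant $c>0$ depending only on $K$ (not on $n,d,\kappa,\Delta,\tau$ or the $f_i$) such that the following holds. (i) If $\tau<\frac n{10}$ and $\tau\le K\,\frac{1}{\sqrt{\Delta}}\max\{1,\frac n\kappa\}$, then ASAGA with step size $\gamma=\frac{a^*(\tau)}{L}$ converges geometrically with rate factor $\rho\ge c\min\{\frac1n,\frac1\kappa\}$, i.e. $\mathbb{E}f(\hat x_t)-f(x^* )\le(1-\rho)^t\tilde C_0$ for all $t\ge0$ with $\tilde C_0$ independent of $t$. Thus its rate factor per update is, up to a constant factor, the one $\frac15\min\{\frac1n,\frac1\kappa\}$ of its sequential counterpart SAGA, and ASAGA is linearly faster than it up to a constant factor. (ii) If moreover $\tau\le K\frac{1}{\sqrt\Delta}$, then there is a universal step size $\gamma=\frac{c'}{L}$, with $c'>0$ depending only on $K$ (in particular not on $\kappa$), for which ASAGA converges geometrically (in the same sense) with rate factor at least $c\min\{\frac1n,\frac1\kappa\}$.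
   Context: Let $f(x)=\frac1n\sum_{i=1}^n f_i(x)$ on $\mathbb{R}^d$, where each $f_i$ is convex and differentiable with $L$-Lipschitz gradient $f_i'$, and $f$ is $\mu$-strongly convex ($\mu>0$). Let $\kappa:=L/\mu$ and let $x^*$ be the minimizer of $f$. $[x]_v$ denotes coordinate $v$ of $x$. For each $i$, $S_i\subseteq\{1,\dots,d\}$ is the support of $f_i'$, i.e. the set of coordinates where $f_i'$ can be nonzero. $P_{S_i}$ is the coordinate projection onto $S_i$; $p_v:=\frac1n|\{i:v\in S_i\}|$; $D$ is diagonal with entries $1/p_v$; $D_i:=P_{S_i}D$. The sparsity constant is $\Delta:=\frac1n\max_{v}|\{i:v\in S_i\}|\in[\frac1n,1]$. ASAGA (asynchronous parallel algorithm, step size $\gamma$). Shared memory holds $x\in\mathbb{R}^d$, initialized at deterministic $x_0$, and $(\alpha_i)_{i=1}^n$, initialized at deterministic $\alpha_i^0$ with support in $S_i$. Several cores repeat in parallel, without locks: (1) read all coordinates of $x$ and of all $\alpha_j$ into local copies $\hat x,\hat\alpha_j$ (possibly inconsistently: coordinates are read at different times while other cores write); (2) sample $i$ uniformly in $\{1,\dots,n\}$; (3) compute $g=f_i'(\hat x)-\hat\alpha_i+D_i\big(\frac1n\sum_{k=1}^n\hat\alpha_k\big)$; (4) for each $v\in S_i$, atomically do $[x]_v\leftarrow[x]_v-\gamma[g]_v$, and write $[\alpha_i]_v\leftarrow[f_i'(\hat x)]_v$. Labeling (''after read''): iterations are labeled $t=0,1,2,\dots$ in the order in which their reads are completed; $\hat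 x_t,\hat\alpha^t$ are the values read, $i_t$ the index sampled and $g_t:=f_{i_t}'(\hat x_t)-\hat\alpha_{i_t}^t+D_{i_t}\big(\frac1n\sum_k\hat\alpha_k^t\big)$ the direction computed by iteration $t$. Independence: $i_t$ is uniform on $\{1,\dots,n\}$ and independent of everything in the past of the completed read $t$, i.e. of all reads $\hat x_u,\hat\alpha^u$ with $u\le t$ and of all $i_u$ with $u<t$ (in particular $i_r$ is independent of $\hat x_t$ for $r\ge t$). Bounded overlap assumption with constant $\tau\ge0$ (integer): an iteration is being processed from the start of its read to the end of its writes, and iterations $r$ and $t$ are never processed concurrently when $r\ge t+\tau+1$; thus all coordinate writes of iteration $t$ are in memory before iteration $t+\tau+1$ starts. Hence, with virtual iterates defined by $x_{t+1}:=x_t-\gamma g_t$ (starting from $x_0$), one has $\hat x_t-x_t=\gamma\sum_{u=(t-\tau)_+}^{t-1}G_u^t g_u$, where the $G_u^t$ are (random) $d\times d$ diagonal matrices with entries in $\{0,1\}$ (entry $1$ meaning that this coordinate write of iteration $u$ was not yet in memory when read by iteration $t$). Similarly each $[\hat\alpha_i^t]_v$ is the most recently written value in memory when read: it equals either $[\alpha_i^0]_v$, which for $v\in S_i$ is only possible if $i_w\ne i$ for all $0\le w\le t-\tau-1$, or $[f_i'(\hat x_u)]_v$ for some $u<t$ with $i_u=i$ and $i_w\neq i$ for all $u+\tau+1\le w\le t-\tau-1$. *)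

(* Defs.v *)
From HB Require Import structures.
From mathcomp Require Export all_boot all_order all_algebra.
From mathcomp Require Export all_classical all_reals all_analysis.

Set Implicit Arguments.
Unset Strict Implicit.
Unset Printing Implicit Defensive.

Export Order.TTheory GRing.Theory Num.Theory.
Export numFieldNormedType.Exports.

Local Open Scope classical_set_scope.
Local Open Scope ring_scope.

Section problem.
Context {R : realType} {d : nat}.
Implicit Types (g : 'rV[R]_d -> R) (x y : 'rV[R]_d).

(* The library norm on 'rV is the sup norm. *)
Definition enorm x : R := Num.sqrt (\sum_v x 0 v ^+ 2).

Definition grad g x : 'rV[R]_d := \row_v 'D_(delta_mx 0 v) g x.

Definition elipschitz (L : R) (h : 'rV[R]_d -> 'rV[R]_d) : Prop :=
  forall x y, enorm (h x - h y) <= L * enorm (x - y).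

Definition strongly_convex (mu : R) g : Prop :=
  convex_function setT (fun x => g x - mu / 2 * enorm x ^+ 2).

Context {n : nat}.
Variable f : 'I_n -> 'rV[R]_d -> R.

Definition objective x : R := n%:R^-1 * \sum_i f i x.

Definition supp (i : 'I_n) : {set 'I_d} :=
  [set v | `[< exists x, grad (f i) x 0 v != 0 >]].

Definition deg (v : 'I_d) : nat := #|[set i | v \in supp i]|.

Definition freq (v : 'I_d) : R := n%:R^-1 * (deg v)%:R.

Definition Dmx : 'M[R]_d := diag_mx (\row_v (freq v)^-1).

Definition Pmx (i : 'I_n) : 'M[R]_d := diag_mx (\row_v (v \in supp i)%:R).

Definition sparsity : R := n%:R^-1 * (\max_(v < d) deg v)%N%:R.

End problem.

Definition a_star {R : realType} (kappa Delta : R) (tau : nat) : R :=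
  (32 * (1 + tau%:R * Num.sqrt Delta) *
   Num.sqrt (1 + (8 * kappa)^-1 * Num.min (Num.sqrt Delta)^-1 tau%:R))^-1.

(* One outcome of a run on shared memory, with the iterations labelled by      *)
(* t : nat.  Every elementary access to a memory cell has a time stamp:        *)
(* [xread t v] and [aread t k v] are the times at which iteration t reads      *)
(* [x]_v and [alpha_k]_v; [xwrite t v] and [awrite t v] are the times at which *)
(* it updates [x]_v and [alpha_(idx t)]_v (relevant for v in the support of    *)
(* f_(idx t) only).                                                            *)
Record execution (R : realType) (n d : nat) := Execution {
  idx : nat -> 'I_n;
  xhat : nat -> 'rV[R]_d;
  ahat : nat -> 'I_n -> 'rV[R]_d;
  start : nat -> R;
  read_end : nat -> R;
  finish : nat -> R;
  xread : nat -> 'I_d -> R;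
  aread : nat -> 'I_n -> 'I_d -> R;
  xwrite : nat -> 'I_d -> R;
  awrite : nat -> 'I_d -> R
}.

Section asaga.
Context {R : realType} {n d : nat}.
Variables (f : 'I_n -> 'rV[R]_d -> R) (gamma : R) (tau : nat).
Variables (x0 : 'rV[R]_d) (alpha0 : 'I_n -> 'rV[R]_d).

Section path.
Variable e : execution R n d.

(* Vectors are rows, so the diagonal matrix D_i = P_(S_i) D acts on the right. *)
Definition direction (t : nat) : 'rV[R]_d :=
  grad (f (idx e t)) (xhat e t) - ahat e t (idx e t)
  + (n%:R^-1 *: \sum_k ahat e t k) *m (Pmx f (idx e t) *m Dmx f).

Definition concurrent (t r : nat) : Prop :=
  start e t <= finish e r /\ start e r <= finish e t.

Record valid_schedule : Prop := ValidSchedule {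
  xread_during_read : forall t v, start e t <= xread e t v <= read_end e t;
  aread_during_read : forall t k v, start e t <= aread e t k v <= read_end e t;
  start_read_end : forall t, start e t <= read_end e t;
  read_end_finish : forall t, read_end e t <= finish e t;
  xwrite_after_read : forall t v, v \in supp f (idx e t) ->
    read_end e t <= xwrite e t v <= finish e t;
  awrite_after_read : forall t v, v \in supp f (idx e t) ->
    read_end e t <= awrite e t v <= finish e t;
  after_read_labels : forall t r, (t <= r)%N -> read_end e t <= read_end e r;
  bounded_overlap : forall t r, (t + tau + 1 <= r)%N -> ~ concurrent t r
}.

(* In [reads_x] and [alpha_written] only iterations u < t can have written before   *)
(* a read of iteration t: those with u >= t write after [read_end e u], hence  *)
(* not before [read_end e t].                                                  *)

Definition reads_x : Prop := forall t v,
  xhat e t 0 v = x0 0 v -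
    \sum_(u < t | (v \in supp f (idx e u)) && (xwrite e u v < xread e t v))
      gamma * direction u 0 v.

Definition alpha_written (t : nat) (k : 'I_n) (v : 'I_d) (u : nat) : Prop :=
  [/\ (u < t)%N, idx e u = k, v \in supp f k & awrite e u v < aread e t k v].

(* For simultaneous writes to the same cell, either value may be the last one. *)
Definition reads_alpha : Prop := forall t k v,
  ((forall u, ~ alpha_written t k v u) /\ ahat e t k 0 v = alpha0 k 0 v)
  \/ (exists u, [/\ alpha_written t k v u,
        forall u', alpha_written t k v u' -> awrite e u' v <= awrite e u v
      & ahat e t k 0 v = grad (f k) (xhat e u) 0 v]).

Definition asaga_path : Prop := [/\ valid_schedule, reads_x & reads_alpha].

End path.

Section random.
Context {disp : measure_display} {T : measurableType disp}.
Variables (P : probability T R) (X : T -> execution R n d).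

(* Generators of the sigma-algebra of the past of the completed read t. *)
Definition past (t : nat) : set (set T) :=
  [set A | exists u v B, [/\ (u <= t)%N, measurable (B : set R) &
             A = [set w | B (xhat (X w) u 0 v)]]] `|`
  [set A | exists u k v B, [/\ (u <= t)%N, measurable (B : set R) &
             A = [set w | B (ahat (X w) u k 0 v)]]] `|`
  [set A | exists u k, (u < t)%N /\ A = [set w | idx (X w) u = k]].

Record asaga_run : Prop := AsagaRun {
  run_path : forall w, asaga_path (X w);
  run_xhat_measurable : forall t v,
    measurable_fun setT (fun w => xhat (X w) t 0 v);
  run_ahat_measurable : forall t k v,
    measurable_fun setT (fun w => ahat (X w) t k 0 v);
  run_idx_measurable : forall t k, measurable [set w | idx (X w) t = k];
  run_idx_uniform : forall t k, P [set w | idx (X w) t = k] = (n%:R^-1)%:E;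
  run_idx_independent : forall t k A, <<s past t >> A ->
    P (A `&` [set w | idx (X w) t = k])
    = (P A * P [set w | idx (X w) t = k])%E
}.

End random.
End asaga.

Definition asaga_converges {R : realType} {n d : nat}
    (f : 'I_n -> 'rV[R]_d -> R) (xstar : 'rV[R]_d) (tau : nat)
    (gamma rho : R) : Prop :=
  forall (x0 : 'rV[R]_d) (alpha0 : 'I_n -> 'rV[R]_d),
    (forall i v, v \notin supp f i -> alpha0 i 0 v = 0) ->
  forall (disp : measure_display) (T : measurableType disp)
    (P : probability T R) (X : T -> execution R n d),
    asaga_run f gamma tau x0 alpha0 P X ->
  exists C0 : R, forall t : nat,
    ('E_P[fun w => objective f (xhat (X w) t)] - (objective f xstar)%:E
     <= ((1 - rho) ^+ t * C0)%:E)%E.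

(* Main.v *)
(* Virtual iterates: with x_(t+1) := x_t - gamma g_t, put                        *)
(*   A_t := E|x_t - xstar|^2,  G_t := E|g_t|^2,  e_t := E f(xhat_t) - f(xstar). *)
(* Unbiasedness and strong convexity give                                     *)
(*   A_(t+1) <= (1 - gamma mu/2) A_t + gamma^2 C1 G_t                         *)
(*        + gamma^2 (sqrt Delta + gamma mu C1) sum_(t-tau <= u < t) G_u         *)
(*        - 2 gamma e_t,                     with C1 := 1 + tau sqrt Delta,    *)
(* where C1 comes from E|<g_u, g_t>| <= (sqrt Delta / 2)(G_u + G_t) for u < t: *)
(* a coordinate of g_u meets the support of g_t with probability at most Delta. *)
(* An entry of the table read at time t dates from iteration u only if its    *)
(* index is not sampled between u + tau + 1 and t - tau - 1, which yields     *)
(*   G_t <= 5 L e_t + (5L/n) sum_(u<t) (1-1/n)^(t-u-1-2tau) e_u               *)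
(*        + O((1-1/n)^(t-tau)).                                               *)
(* Multiplying by (1-rho)^-(t+1), summing over t and exchanging sums, the G   *)
(* terms are absorbed by the -2 gamma e_t, so (1-rho)^-t e_t stays bounded.   *)
(* Only finitely many values are possible for the memory at time t, since it  *)
(* starts deterministic; hence all random variables below are simple.         *)
(* For the universal step size, f is used as a strongly convex function with  *)
(* the possibly smaller modulus min(mu, L/n).                                 *)
Require Import Defs.
From mathcomp Require Import ring lra zify.

Set Implicit Arguments.
Unset Strict Implicit.
Unset Printing Implicit Defensive.

Local Open Scope classical_set_scope.
Local Open Scope ring_scope.

(** * Convex functions with Lipschitz gradients *)

(** The virtual iterates perform gradient steps that are unbiased at the stale point xhat_t. Because
    reads precede sampling, i_t is independent of xhat_t and of the table, so the SAGA correction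
    averages out ([mean_mulmx_PD], [Ex_dot_direction]). Three errors remain. The lag xhat_t - x_t
    is, coordinatewise, a partial sum of at most tau recent directions ([xhat_virtual_le]); its
    inner product with g_t and its own square are small because two directions share few coordinates
    ([Ex_overlap_lt], [lag_sqr_le]). The size of g_t is controlled by the suboptimality at the
    present point and at the past points stored in the table ([gsqr_le], [ahat_sqr_le],
    [gradient_table_error_le]), through co-coercivity of the gradients ([dot_grad_diff_sqr_le]).

    Together these give [vdist_rec], and the rest is deterministic: [recursion_converges] solves the
    coupled recursion under two inequalities on gamma. [a_star] satisfies both ([a_star_overlap],
    [a_star_overlap_strong]) and stays large enough ([a_star_rate]) while tau is within its bound.
    The rate is the smaller of 1/(10n), tied to the refreshing of the table, and gamma mu'/2, the
    contraction due to strong convexity with a modulus mu' <= mu. *)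

Section dot_product.
Context {R : realType} {d : nat}.
Implicit Types x y z : 'rV[R]_d.

Definition dot x y : R := \sum_v x 0 v * y 0 v.

Lemma dotC x y : dot x y = dot y x.
Proof. by apply: eq_bigr => v _; rewrite mulrC. Qed.

Lemma dotDl x y z : dot (x + y) z = dot x z + dot y z.
Proof. by rewrite -big_split; apply: eq_bigr => v _; rewrite !mxE mulrDl. Qed.

Lemma dotZl a x y : dot (a *: x) y = a * dot x y.
Proof. by rewrite mulr_sumr; apply: eq_bigr => v _; rewrite !mxE mulrA. Qed.

Lemma dotNl x y : dot (- x) y = - dot x y.
Proof. by rewrite -scaleN1r dotZl mulN1r. Qed.

Lemma dotDr x y z : dot z (x + y) = dot z x + dot z y.
Proof. by rewrite !(dotC z) dotDl. Qed.

Lemma dotZr a x y : dot y (a *: x) = a * dot y x.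
Proof. by rewrite !(dotC y) dotZl. Qed.

Lemma dotNr x y : dot y (- x) = - dot y x.
Proof. by rewrite !(dotC y) dotNl. Qed.

Lemma dot0l x : dot 0 x = 0.
Proof. by rewrite -(scale0r 0) dotZl mul0r. Qed.

Definition dotE := (dotDl, dotDr, dotNl, dotNr, dotZl, dotZr).

Lemma dot_suml (I : Type) (r : seq I) (F : I -> 'rV[R]_d) x :
  dot (\sum_(i <- r) F i) x = \sum_(i <- r) dot (F i) x.
Proof. by elim/big_rec2: _ => [|i u1 u2 _ <-]; rewrite ?dot0l ?dotDl. Qed.

Lemma dotxx x : dot x x = \sum_v x 0 v ^+ 2.
Proof. by apply: eq_bigr => v _; rewrite expr2. Qed.

Lemma dotxx_ge0 x : 0 <= dot x x.
Proof. by rewrite dotxx sumr_ge0 // => v _; exact: sqr_ge0. Qed.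

Lemma dotxx_eq0 x : dot x x <= 0 -> x = 0.
Proof.
move=> x0; apply/rowP => v; rewrite mxE.
have : x 0 v ^+ 2 <= 0.
  apply: le_trans x0; rewrite dotxx (bigD1 v) //= lerDl.
  by apply: sumr_ge0 => w _; exact: sqr_ge0.
move=> h; apply/eqP; rewrite -sqrf_eq0.
by apply/eqP/le_anti; rewrite h sqr_ge0.
Qed.

Lemma enorm_sqr x : enorm x ^+ 2 = dot x x.
Proof. by rewrite /enorm sqr_sqrtr -dotxx // dotxx_ge0. Qed.

Lemma enorm_ge0 x : 0 <= enorm x.
Proof. exact: sqrtr_ge0. Qed.

Lemma dot_young (c : R) x y : 0 < c ->
  dot x y <= (2 * c)^-1 * dot x x + c / 2 * dot y y.
Proof.
move=> c0; have := dotxx_ge0 (c^-1 *: x - y).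
have c2 : 0 <= c / 2 by rewrite divr_ge0 // ltW.
rewrite !dotE (dotC y x) => /(mulr_ge0 c2).
set X := dot x x; set Y := dot y y; set Z := dot x y.
rewrite -(subr_ge0 Z); congr (_ <= _); field; exact: lt0r_neq0.
Qed.

Lemma dot_sub_le x y : dot (x - y) (x - y) <= 2 * dot x x + 2 * dot y y.
Proof.
have := dotxx_ge0 (x + y); rewrite !dotE (dotC y x); lra.
Qed.

End dot_product.

Section gradient.
Context {R : realType} {d : nat}.
Implicit Types (f : 'rV[R]_d -> R) (x y h : 'rV[R]_d).

Lemma derive_grad f x h : differentiable f x -> 'D_h f x = dot (grad f x) h.
Proof.
move=> df; rewrite deriveE // {1}[h]row_sum_delta linear_sum.
apply: eq_bigr => v _; rewrite linearZ /= mxE deriveE //.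
by rewrite mulrC.
Qed.

Lemma convex_functionE f x y (s : R) : convex_function setT f -> 0 <= s <= 1 ->
  f (x + s *: (y - x)) <= f x + s * (f y - f x).
Proof.
move=> cf s01; have s01' : Itv.spec (@Itv.num_sem R) (Itv.Real `[0, 1]%Z) s.
  by rewrite /Itv.spec /Itv.num_sem /= realE in_itv /=; case/andP: s01 => -> ->.
have h : f (s *: y + (1 - s) *: x) <= s * f y + (1 - s) * f x.
  by apply: (cf (Itv.mk s01') y x); rewrite inE.
rewrite (_ : x + s *: (y - x) = s *: y + (1 - s) *: x).
  by apply: le_trans h _; rewrite le_eqVlt; apply/orP; left; apply/eqP; ring.
by apply/rowP => v; rewrite !mxE; ring.
Qed.

(** By convexity the right difference quotients along y - x are at most f y - f x; pass to the
    limit. *)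
Lemma convex_grad_le f x y : convex_function setT f -> differentiable f x ->
  f x + dot (grad f x) (y - x) <= f y.
Proof.
move=> cf df; rewrite -lerBrDl -derive_grad //.
have dv : derivable f x (y - x) by exact: diff_derivable.
have cv : (fun h : R => h^-1 *: ((f \o shift x) (h *: (y - x)) - f x)) @ 0^'+
   --> 'D_(y - x) f x by apply: cvg_dnbhs_at_right; exact: dv.
rewrite -(cvg_lim _ cv) //; apply: limr_le; first by apply/cvg_ex; eexists; exact: cv.
near=> s; rewrite /GRing.scale /=.
have s0 : 0 < s by near: s; exact: nbhs_right_gt.
have s1 : s <= 1 by near: s; exact: nbhs_right_le.
rewrite ler_pdivrMl // lerBlDl (addrC _ x).
by apply: convex_functionE => //; rewrite (ltW s0).
Unshelve. all: by end_near. Qed.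

Lemma elipschitz_sqr L (g : 'rV[R]_d -> 'rV[R]_d) x y : elipschitz L g ->
  dot (g x - g y) (g x - g y) <= L ^+ 2 * dot (x - y) (x - y).
Proof.
move=> lg; rewrite -!enorm_sqr -exprMn; have := lg x y.
have := enorm_ge0 (g x - g y); set a := enorm _; set b := _ * _ => a0 ab.
by rewrite ler_pXn2r // nnegrE (le_trans a0).
Qed.

End gradient.

Section smooth_convex.
Context {R : realType} {d : nat}.
Variables (f : 'rV[R]_d -> R) (L : R).
Hypotheses (cf : convex_function setT f) (df : forall x, differentiable f x).
Hypotheses (Lf : elipschitz L (grad f)) (L0 : 0 < L).
Implicit Types x y h : 'rV[R]_d.

(** A descent inequality obtained without integrating along a segment: convexity gives c = L, and
    halving at midpoints brings c towards the classical L / 2. *)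
Definition quadratic_upper (c : R) := forall x h,
  f (x + h) <= f x + dot (grad f x) h + c * dot h h.

Lemma dot_grad_diff_le x h :
  dot (grad f (x + h) - grad f x) h <= L * dot h h.
Proof.
apply: le_trans (dot_young _ _ L0) _.
have := elipschitz_sqr (x + h) x Lf; rewrite (addrC x) addrK => hL.
have Lm : 0 <= (2 * L)^-1 by rewrite invr_ge0 mulr_ge0 // ltW.
have := ler_wpM2l Lm hL; set u := _^-1 * dot _ _; set H := dot h h.
rewrite (_ : _ * (_ * _) = L / 2 * H); last by field; exact: lt0r_neq0.
lra.
Qed.

Lemma quadratic_upper_L : quadratic_upper L.
Proof.
move=> x h; have := convex_grad_le x cf (df (x + h)).
have := dot_grad_diff_le x h; rewrite opprD addNKr !dotE; lra.
Qed.

(* Going through the midpoint; L / 2 is the fixed point of c |-> c/2 + L/4. *)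
Lemma quadratic_upper_half c : quadratic_upper c -> quadratic_upper (c / 2 + L / 4).
Proof.
move=> Hc x h; pose k := 2^-1 *: h.
have hk : h = k + k by rewrite -scalerDl (_ : 2^-1 + 2^-1 = 1) ?scale1r //; field.
have := Hc (x + k) k; have := Hc x k; have := dot_grad_diff_le x k.
have -> : x + h = x + k + k by rewrite hk addrA.
rewrite hk !dotE; lra.
Qed.

(** Two halvings, L to 3L/4 to 5L/8; hence the constants 5/2 and 5 below in place of the classical 2
    and 4. *)
Lemma quadratic_upper_5_8 : quadratic_upper (5 / 8 * L).
Proof.
move=> x h; have := quadratic_upper_half (quadratic_upper_half quadratic_upper_L) x h.
by have -> : (L / 2 + L / 4) / 2 + L / 4 = 5 / 8 * L by field.
Qed.

(** Co-coercivity: at y + h, f lies above its tangent at x and below its quadratic bound at y;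
    compare the two. *)
Lemma dot_grad_diff_sqr_le x y :
  dot (grad f y - grad f x) (grad f y - grad f x) <=
  5 / 2 * L * (f y - f x - dot (grad f x) (y - x)).
Proof.
have [g gE] : exists g, grad f y = grad f x + g.
  by exists (grad f y - grad f x); rewrite addrC subrK.
have -> : grad f y - grad f x = g by rewrite gE addrAC subrr add0r.
(* The minimiser - g / (2c) of the difference of the two bounds, for c = 5L/8. *)
pose h := - (4 / (5 * L)) *: g.
have h1 := quadratic_upper_5_8 y h.
have h2 := convex_grad_le (y + h) cf (df x).
move: h1 h2; rewrite gE /h !dotE.
set G := dot g g; set A := dot _ g; set B := dot _ y; set C := dot _ x.
move=> h1 h2.
have h3 : B - C + f x <= f y - 2 / (5 * L) * G.
  have -> : 2 / (5 * L) * G = 4 / (5 * L) * G -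
    5 / 8 * L * (- (4 / (5 * L)) * (- (4 / (5 * L)) * G)).
    by field; exact: lt0r_neq0.
  move: h1 h2; lra.
have -> : G = 5 / 2 * L * (2 / (5 * L) * G) by field; exact: lt0r_neq0.
apply: ler_wpM2l; first by rewrite mulr_ge0 // ?ltW // divr_ge0.
by move: h3; lra.
Qed.

End smooth_convex.

(** * Averages over the components: unbiasedness, variance, strong convexity *)

Section finite_sum.
Context {R : realType} {n d : nat}.
Variables (f : 'I_n -> 'rV[R]_d -> R) (L mu : R) (xstar : 'rV[R]_d).
Hypothesis n0 : (0 < n)%N.
Implicit Types x y h : 'rV[R]_d.

Definition mean_grad x : 'rV[R]_d := n%:R^-1 *: \sum_k grad (f k) x.

Lemma grad_supp k x v : v \notin supp f k -> grad (f k) x 0 v = 0.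
Proof.
rewrite inE => /negP H; apply/eqP; apply/negP => /negP H'; apply: H.
by apply/asboolP; exists x.
Qed.

Let nV : 0 < (n%:R : R)^-1. Proof. by rewrite invr_gt0 ltr0n. Qed.

Lemma mulmx_PD (k : 'I_n) (b : 'rV[R]_d) v :
  (b *m (Pmx f k *m Dmx f)) 0 v = b 0 v * ((v \in supp f k)%:R * (freq f v)^-1).
Proof.
rewrite mulmxA /Pmx /Dmx !mul_mx_diag !mxE; rewrite mulrA //.
Qed.

Lemma in_deg_set v k : (k \in [set i | v \in supp f i]%classic) = (v \in supp f k).
Proof. by apply/idP/idP; rewrite inE. Qed.

Lemma mean_const (c : R) : n%:R^-1 * \sum_(k < n) c = c.
Proof.
by rewrite sumr_const card_ord -[c *+ n]mulr_natl mulKf // pnatr_eq0 -lt0n.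
Qed.

Lemma freq_sum v : n%:R^-1 * \sum_k (v \in supp f k)%:R = freq f v :> R.
Proof.
rewrite /freq /deg -sum1_card natr_sum; congr (_ * _).
by rewrite [RHS]big_mkcond /=; apply: eq_bigr => k _; rewrite in_deg_set; case: ifP.
Qed.

Lemma freq_eq0 v : freq f v = 0 -> forall k, v \notin supp f k.
Proof.
move/eqP; rewrite /freq mulf_eq0 (gt_eqF nV) /= pnatr_eq0 => /eqP /card0_eq e k.
by rewrite -in_deg_set e.
Qed.

Section supported.
Variable b : 'I_n -> 'rV[R]_d.
Hypothesis bsupp : forall k v, v \notin supp f k -> b k 0 v = 0.
Let mb := n%:R^-1 *: \sum_k b k.

(* If no index touches v, freq f v = 0 and its inverse is the junk value 0, but
   then mb vanishes at v. *)
Lemma mean_freq v : mb 0 v * ((freq f v)^-1 * freq f v) = mb 0 v.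
Proof.
have [f0|f0] := eqVneq (freq f v) 0; last by rewrite mulVf ?mulr1.
rewrite /mb !mxE summxE big1 ?mulr0 ?mul0r // => k _.
by apply: bsupp; exact: freq_eq0.
Qed.

(** Unbiasedness of the correction: coordinate v survives for a fraction [freq f v] of the indices,
    which cancels the entry of [Dmx]. *)
Lemma mean_mulmx_PD : n%:R^-1 *: \sum_k mb *m (Pmx f k *m Dmx f) = mb.
Proof.
apply/rowP => v; rewrite mxE summxE.
under eq_bigr do rewrite mulmx_PD mulrCA mulrC.
by rewrite -mulr_sumr mulrCA freq_sum -mulrA mean_freq.
Qed.

(** A variance identity in each coordinate: with m = mb_v and p = [freq f v], the mean square drops
    by m^2 / p. *)
Lemma variance_PD_le :
  n%:R^-1 * \sum_k dot (b k - mb *m (Pmx f k *m Dmx f)) (b k - mb *m (Pmx f k *m Dmx f))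
  <= n%:R^-1 * \sum_k dot (b k) (b k).
Proof.
rewrite /dot exchange_big [X in _ <= _ * X]exchange_big /= !mulr_sumr.
apply: ler_sum => v _.
have -> : \sum_k ((b k - mb *m (Pmx f k *m Dmx f)) 0 v * (b k - mb *m (Pmx f k *m Dmx f)) 0 v)
  = \sum_k (b k 0 v * b k 0 v) - (2 * mb 0 v * (freq f v)^-1) * \sum_k b k 0 v
   + (mb 0 v * (freq f v)^-1) ^+ 2 * \sum_k (v \in supp f k)%:R.
  rewrite !mulr_sumr -sumrB -big_split /=; apply: eq_bigr => k _.
  rewrite mxE [X in _ + X]mxE mulmx_PD; case: (boolP (v \in supp f k)) => /= vk; first by ring.
  by rewrite bsupp //; ring.
have -> : \sum_k b k 0 v = n%:R * mb 0 v.
  by rewrite /mb !mxE summxE mulVKf // pnatr_eq0 -lt0n.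
have -> : \sum_k (v \in supp f k)%:R = n%:R * freq f v :> R.
  by rewrite -freq_sum mulVKf // pnatr_eq0 -lt0n.
apply: ler_wpM2l; first exact: ltW.
rewrite -addrA gerDl.
have := mean_freq v; set m := mb 0 v; set p := freq f v => e.
have p0 : 0 <= p^-1.
  by rewrite invr_ge0 /p /freq mulr_ge0 // ltW.
have -> : - (2 * m / p * (n%:R * m)) + (m / p) ^+ 2 * (n%:R * p) =
   n%:R * (m * (m * (p^-1 * p)) / p - 2 * m ^+ 2 / p) by ring.
rewrite e (_ : _ - _ = - (m ^+ 2 / p)); last by ring.
rewrite mulrN oppr_le0; apply: mulr_ge0 => //.
by apply: mulr_ge0 => //; exact: sqr_ge0.
Qed.

End supported.

Hypothesis cf : forall i, convex_function setT (f i).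
Hypothesis df : forall i x, differentiable (f i) x.
Hypothesis Lf : forall i, elipschitz L (grad (f i)).

Lemma objective_grad_le x y :
  objective f x + dot (mean_grad x) (y - x) <= objective f y.
Proof.
rewrite /objective /mean_grad dotZl dot_suml -mulrDr -big_split /=.
apply: ler_wpM2l; first exact: ltW.
by apply: ler_sum => k _; apply: convex_grad_le.
Qed.

Hypothesis mu0 : 0 < mu.
Hypothesis scf : strongly_convex mu (objective f).

(** Convexity of objective - mu/2 |.|^2 on the segment and the tangent at x, both taken at x + s (y
    - x), give after division by s the claim with mu (1 - s) for mu; then let s tend to 0. *)
Lemma objective_strong_grad_le x y :
  objective f x + dot (mean_grad x) (y - x) + mu / 2 * dot (y - x) (y - x)
  <= objective f y.
Proof.
set D := dot (y - x) (y - x).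
have key (s : R) : 0 < s <= 1 ->
    dot (mean_grad x) (y - x) + mu / 2 * (1 - s) * D <= objective f y - objective f x.
  case/andP=> s0 s1.
  have := convex_functionE x y scf; move=> /(_ s); rewrite (ltW s0) s1 => /(_ isT).
  have := objective_grad_le x (x + s *: (y - x)).
  rewrite addrAC subrr add0r !enorm_sqr !dotZr /D !dotE (dotC y x) => h1 h2.
  rewrite -(ler_pM2l s0); move: h1 h2.
  set a := dot x x; set b := dot x y; set c := dot y y.
  set u := dot _ y; set v := dot _ x; lra.
have D0 : 0 <= mu / 2 * D by rewrite mulr_ge0 ?dotxx_ge0 // divr_ge0 // ltW.
(* The limit is taken by contradiction: if the gap E is negative, the explicit s below is so small
   that s mu D / 2 < - E, against [key]. *)
pose E := objective f y - objective f x - dot (mean_grad x) (y - x) - mu / 2 * D.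
have [E0|E0] := leP 0 E; first by move: E0; rewrite /E; lra.
have mD : 0 < mu / 2 * D + 1 - E by move: E0; lra.
have s0 : 0 < - E / (mu / 2 * D + 1 - E) by rewrite divr_gt0 // oppr_gt0.
have /key : 0 < - E / (mu / 2 * D + 1 - E) <= 1.
  by rewrite s0 /= ler_pdivrMr // mul1r; lra.
set s := - E / _ in s0 *.
have : s * (mu / 2 * D) < - E.
  rewrite /s mulrAC ltr_pdivrMr // ltr_pM2l ?oppr_gt0 //.
  by move: E0; lra.
by rewrite /E; lra.
Qed.

Hypothesis d0 : (0 < d)%N.

(** If L <= 0, every gradient agrees at 0 and at the all-ones vector, against strong convexity; d >
    0 makes that vector nonzero. *)
Lemma lipschitz_gt0 : 0 < L.
Proof.
rewrite ltNge; apply/negP => L0.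
pose z : 'rV[R]_d := const_mx 1.
have z0 : 0 < dot z z.
  rewrite lt_def dotxx_ge0 andbT; apply/negP => /eqP e.
  have /rowP/(_ (Ordinal d0)) : z = 0 by apply: dotxx_eq0; rewrite e.
  by rewrite !mxE => /eqP; rewrite oner_eq0.
have gz k : grad (f k) z = grad (f k) 0.
  apply/eqP; rewrite -subr_eq0; apply/eqP; apply: dotxx_eq0.
  rewrite -enorm_sqr; have := Lf k z 0; set e := enorm _ => h.
  have e0 : e <= 0 by apply: le_trans h _; rewrite mulr_le0_ge0 ?enorm_ge0.
  have -> : e = 0 by apply/le_anti; rewrite e0 enorm_ge0.
  by rewrite expr2 mulr0.
have := objective_strong_grad_le 0 z; have := objective_strong_grad_le z 0.
have -> : mean_grad z = mean_grad 0.
  by rewrite /mean_grad; congr (_ *: _); apply: eq_bigr => k _.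
rewrite !subr0 !sub0r !dotE.
have := mulr_gt0 mu0 z0; lra.
Qed.

Hypothesis xmin : forall x, objective f xstar <= objective f x.

(** A gradient step of length 4 / (5L) from xstar would lower the objective by at least 2 / (5L)
    times the squared gradient. *)
Lemma mean_grad_min : mean_grad xstar = 0.
Proof.
have L0 := lipschitz_gt0.
set g := mean_grad xstar.
apply: dotxx_eq0.
have h1 : objective f (xstar - (4 / (5 * L)) *: g) <=
   objective f xstar + dot g (- (4 / (5 * L)) *: g) +
    5 / 8 * L * dot (- (4 / (5 * L)) *: g) (- (4 / (5 * L)) *: g).
  have -> : 5 / 8 * L * dot (- (4 / (5 * L)) *: g) (- (4 / (5 * L)) *: g)
    = n%:R^-1 * \sum_(k < n) 5 / 8 * L * dot (- (4 / (5 * L)) *: g) (- (4 / (5 * L)) *: g).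
    by rewrite mean_const.
  rewrite /g /objective dotZl -/g dot_suml -!mulrDr -!big_split /=.
  apply: ler_wpM2l; first exact: ltW.
  apply: ler_sum => k _; rewrite -scaleNr.
  exact: (quadratic_upper_5_8 (cf k) (df k) (Lf k) L0).
clearbody g; have := le_trans (xmin _) h1; rewrite !dotE.
set G := dot g g.
have -> : 5 / 8 * L * (- (4 / (5 * L)) * (- (4 / (5 * L)) * G)) = 2 / (5 * L) * G.
  by field; exact: lt0r_neq0.
have -> : (- (4 / (5 * L)) * G) = - (2 * (2 / (5 * L) * G)).
  by field; exact: lt0r_neq0.
move=> h2; have h3 : 2 / (5 * L) * G <= 0 by lra.
by move: h3; rewrite pmulr_rle0 // divr_gt0 // mulr_gt0.
Qed.

(** Average of [dot_grad_diff_sqr_le]; the linear terms cancel because the mean gradient vanishes at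
    xstar. *)
Lemma mean_grad_diff_sqr_le x :
  n%:R^-1 * \sum_k dot (grad (f k) x - grad (f k) xstar) (grad (f k) x - grad (f k) xstar)
  <= 5 / 2 * L * (objective f x - objective f xstar).
Proof.
have L0 := lipschitz_gt0.
have -> : 5 / 2 * L * (objective f x - objective f xstar) =
  n%:R^-1 * \sum_k 5 / 2 * L * (f k x - f k xstar - dot (grad (f k) xstar) (x - xstar)).
  rewrite -mulr_sumr !sumrB -dot_suml /objective.
  have : dot (mean_grad xstar) (x - xstar) = 0 by rewrite mean_grad_min dot0l.
  rewrite /mean_grad dotZl; set D := dot _ _ => e.
  have -> : D = 0 by apply/eqP; move/eqP: e; rewrite mulf_eq0 (gt_eqF nV).
  by ring.
apply: ler_wpM2l; first exact: ltW.
by apply: ler_sum => k _; apply: dot_grad_diff_sqr_le.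
Qed.

(** If no index touched any coordinate, all gradients would vanish, against strong convexity. *)
Lemma sparsity_gt0 : 0 < sparsity f.
Proof.
rewrite mulr_gt0 // ltr0n lt0n; apply/negP => /eqP m0.
have g0 k x : grad (f k) x = 0.
  apply/rowP => v; rewrite [RHS]mxE; apply: grad_supp; apply: freq_eq0.
  rewrite /freq (_ : deg f v = 0%N) ?mulr0 //; apply/eqP; rewrite -leqn0 -m0.
  exact: (leq_bigmax v).
have mg0 x : mean_grad x = 0 by rewrite /mean_grad big1 ?scaler0.
pose z : 'rV[R]_d := const_mx 1.
have z0 : 0 < dot z z.
  rewrite lt_def dotxx_ge0 andbT; apply/negP => /eqP e.
  have /rowP/(_ (Ordinal d0)) : z = 0 by apply: dotxx_eq0; rewrite e.
  by rewrite !mxE => /eqP; rewrite oner_eq0.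
have := objective_strong_grad_le 0 z; have := objective_strong_grad_le z 0.
rewrite !mg0 !dot0l !subr0 !sub0r !dotE.
have := mulr_gt0 mu0 z0; lra.
Qed.

Lemma freq_le_sparsity v : freq f v <= sparsity f.
Proof.
rewrite /freq /sparsity ler_pM2l // ler_nat; exact: (leq_bigmax v).
Qed.

End finite_sum.

(** * The scalar recursion and the step size *)

Section geometric_recursion.
Context {R : realType}.

(** Young's inequality for convolutions: s^(t+1) = s^(t-u) s^(u+1), so after exchanging sums each e
    u carries a partial sum of the weighted kernel. *)
Lemma convolution_le (s M : R) (c e : nat -> R) (T : nat) :
  0 < s -> (forall k, 0 <= c k) -> (forall u, 0 <= e u) ->
  (forall N, \sum_(k < N) s ^+ k.+1 * c k.+1 <= M) ->
  \sum_(t < T) s ^+ t.+1 * \sum_(u < t) c (t - u)%N * e u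
  <= M * \sum_(u < T) s ^+ u.+1 * e u.
Proof.
move=> s0 c0 e0 cM.
have -> : \sum_(t < T) s ^+ t.+1 * \sum_(u < t) c (t - u)%N * e u =
    \sum_(t < T) \sum_(u < T | (u < t)%N) s ^+ t.+1 * (c (t - u)%N * e u).
  apply: eq_bigr => t _; rewrite mulr_sumr.
  rewrite (big_ord_widen_cond T xpredT (fun u => s ^+ t.+1 * (c (t - u)%N * e u))) //.
  by apply: ltnW.
rewrite (exchange_big_dep xpredT) //= mulr_sumr; apply: ler_sum => u _.
have -> : \sum_(t < T | (u < t)%N) s ^+ t.+1 * (c (t - u)%N * e u) =
    \sum_(k < T - u.+1) (s ^+ k.+1 * c k.+1) * (s ^+ u.+1 * e u).
  rewrite -(big_mkord (fun t => (u < t)%N) (fun t => s ^+ t.+1 * (c (t - u)%N * e u))).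
  rewrite -(big_nat_widenl u.+1 0%N T xpredT) //= -[u.+1]add0n big_addn big_mkord add0n.
  apply: eq_bigr => k _; have -> : (k + u.+1 - u = k.+1)%N by lia.
  have -> : ((k + u.+1).+1 = k.+1 + u.+1)%N by lia.
  by rewrite exprD; ring.
rewrite -mulr_suml; apply: ler_wpM2r; last exact: cM.
by rewrite mulr_ge0 // exprn_ge0 // ltW.
Qed.


(** By Bernoulli (1 - rho)^k >= 1 - k rho, and k rho <= (n/5 + 1) / (10n) <= 3/25 < 1/8. *)
Lemma expr_inv_le (rho : R) (n tau k : nat) : (0 < n)%N ->
  tau%:R < n%:R / 10 :> R -> 0 <= rho -> rho <= (10 * n%:R)^-1 ->
  (k <= 2 * tau + 1)%N -> (1 - rho)^-1 ^+ k <= 8 / 7.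
Proof.
move=> n0 tn r0 rn kt.
have n1 : (1 : R) <= n%:R by rewrite ler1n.
have n0' : (0 : R) < n%:R by rewrite ltr0n.
have rn' : rho * (10 * n%:R) <= 1.
  by rewrite -ler_pdivlMr ?mulr_gt0 // mul1r.
have rho1 : 0 < 1 - rho.
  by have := ler_wpM2l r0 n1; move: rn'; lra.
have bern (j : nat) : 1 - j%:R * rho <= (1 - rho) ^+ j.
  elim: j => [|j IH]; first by rewrite mul0r subr0 expr0.
  have r1 : 0 <= 1 - rho by rewrite ltW.
  have := ler_wpM2r r1 IH; rewrite -exprSr; apply: le_trans.
  have j0 : (0 : R) <= j%:R by [].
  have := mulr_ge0 j0 (sqr_ge0 rho); rewrite -natr1; lra.
rewrite exprVn invf_ple ?posrE ?exprn_gt0 //.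
apply: le_trans (bern k).
have : (k%:R : R) <= 2 * tau%:R + 1 by rewrite -natrM natr1 ler_nat -addn1.
move=> /(ler_wpM2r r0) kr; have := ler_wpM2r r0 (ltW tn).
have := ler_wpM2l r0 n1.
rewrite invf_div; move: kr rn'; lra.
Qed.

Lemma sum_ltn_minn (N m : nat) : (\sum_(i < N) (i < m) = minn N m)%N.
Proof.
elim: N => [|N IH]; first by rewrite big_ord0 min0n.
by rewrite big_ord_recr /= IH; lia.
Qed.

Section recursion.
Variables (n tau : nat) (rho : R).
Hypotheses (n0 : (0 < n)%N) (tn : tau%:R < n%:R / 10 :> R).
Hypotheses (rho0 : 0 <= rho) (rhon : rho <= (10 * n%:R)^-1).
Let q : R := 1 - n%:R^-1.
Let s : R := (1 - rho)^-1.

Let n1 : (1 : R) <= n%:R. Proof. by rewrite ler1n. Qed.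
Let nV1 : (n%:R : R)^-1 <= 1. Proof. by rewrite invf_le1 // ltr0n. Qed.
Let nV0 : 0 < (n%:R : R)^-1. Proof. by rewrite invr_gt0 ltr0n. Qed.
Let rhon' : rho <= n%:R^-1 / 10.
Proof. by apply: le_trans rhon _; rewrite invfM mulrC. Qed.
Let rho1 : 0 < 1 - rho. Proof. by move: nV1 rhon'; lra. Qed.
Let s0 : 0 < s. Proof. by rewrite invr_gt0. Qed.
Let q0 : 0 <= q. Proof. by rewrite subr_ge0. Qed.
Let q1 : q <= 1. Proof. by rewrite gerBl ltW. Qed.
Let s87 k : (k <= 2 * tau + 1)%N -> s ^+ k <= 8 / 7.
Proof. exact: (expr_inv_le n0 tn rho0 rhon). Qed.

Lemma window_weight N :
  \sum_(k < N) s ^+ k.+1 * ((k.+1 <= tau)%N)%:R <= 8 / 7 * tau%:R.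
Proof.
have h (k : nat) : s ^+ k.+1 * (k.+1 <= tau)%N%:R <= 8 / 7 * (k < tau)%N%:R.
  case: (leqP k.+1 tau) => kt; rewrite ?mulr0 // !mulr1; apply: s87.
  by rewrite (leq_trans kt) // mul2n -addnn -addnA leq_addr.
apply: le_trans (ler_sum _ (fun (k : 'I_N) _ => h k)) _.
rewrite -mulr_sumr; apply: ler_wpM2l; first by [].
rewrite -natr_sum ler_nat.
by rewrite sum_ltn_minn geq_minr.
Qed.

(* Bounded by 2 tau terms of size 8/7 plus a geometric series of ratio at most
   1 - 9/(10n). *)
Lemma geometric_weight N :
  \sum_(k < N) s ^+ k.+1 * q ^+ (k - 2 * tau) <= 3 / 2 * n%:R.
Proof.
have sq : s * q <= 1 - 9 / 10 * n%:R^-1.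
  rewrite mulrC ler_pdivrMr //; rewrite /q; move: nV0 nV1 rho0 rhon'.
  set z := n%:R^-1 => z0 z1 rh0 rhz.
  have := mulr_ge0 (ltW z0) rh0; lra.
have nz : n%:R * n%:R^-1 = 1 :> R by rewrite mulfV // pnatr_eq0 -lt0n.
have head M : (M <= 2 * tau)%N ->
    \sum_(k < M) s ^+ k.+1 * q ^+ (k - 2 * tau) <= 8 / 7 * M%:R.
  elim: M => [|M IH] M2; first by rewrite big_ord0 mulr0.
  rewrite big_ord_recr /= -[M.+1%:R]natr1 mulrDr mulr1; apply: lerD; first exact: IH (ltnW M2).
  have -> : (M - 2 * tau = 0)%N by apply/eqP; rewrite subn_eq0 ltnW.
  by rewrite expr0 mulr1; apply: s87; rewrite (leq_trans M2) // leq_addr.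
(* Telescoping form of the geometric tail: summands now shrink by s q <= 1 - 9/(10n), so 10n/9 times
   the next one bounds all that is still to come. *)
have tail j : \sum_(k < 2 * tau + j) s ^+ k.+1 * q ^+ (k - 2 * tau) +
    10 / 9 * n%:R * (s ^+ (2 * tau + j).+1 * q ^+ j) <=
    8 / 7 * (2 * tau)%N%:R + 10 / 9 * n%:R * (8 / 7).
  elim: j => [|j IH].
    rewrite addn0 expr0 mulr1; apply: lerD; first exact: head.
    by apply: ler_wpM2l; [apply: mulr_ge0 | apply: s87; rewrite addn1].
  apply: le_trans IH; rewrite addnS big_ord_recr /= addrAC -addrA lerD2l.
  rewrite addKn.
  rewrite [in X in X + _]exprS [q ^+ j.+1]exprS.
  set S := s ^+ (2 * tau + j).+1; set Q := q ^+ j.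
  have SQ : 0 <= S * Q by rewrite mulr_ge0 ?exprn_ge0 // ltW.
  have h1 : S * Q * (s * q) <= S * Q * (1 - 9 / 10 * n%:R^-1) by apply: ler_wpM2l.
  have h2 := ler_wpM2l (ler0n R n) h1.
  have e : n%:R * (S * Q * (1 - 9 / 10 * n%:R^-1)) = n%:R * (S * Q) - 9 / 10 * (S * Q).
    by field; rewrite pnatr_eq0 -lt0n.
  rewrite e in h2.
  have -> : 10 / 9 * n%:R * (s * S * (q * Q)) = 10 / 9 * (n%:R * (S * Q * (s * q))) by ring.
  have -> : 10 / 9 * n%:R * (S * Q) = 10 / 9 * (n%:R * (S * Q)) by ring.
  lra.
have mono M : \sum_(k < N) s ^+ k.+1 * q ^+ (k - 2 * tau) <=
   \sum_(k < M + N) s ^+ k.+1 * q ^+ (k - 2 * tau).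
  elim: M => [|M IH] //; rewrite addSn big_ord_recr /=; apply: le_trans IH _.
  by rewrite lerDl mulr_ge0 ?exprn_ge0 // ltW.
apply: le_trans (mono (2 * tau)%N) _; have := tail N.
have : 0 <= 10 / 9 * n%:R * (s ^+ (2 * tau + N).+1 * q ^+ N).
  apply: mulr_ge0; first exact: mulr_ge0.
  by rewrite mulr_ge0 ?exprn_ge0 // ltW.
(* The total is at most (8/7 * 2/10 + 10/9 * 8/7) n < 3n/2. *)
rewrite natrM; move: tn n1; lra.
Qed.

Variables (A G e : nat -> R) (gamma L mu r B0 : R).
Let C1 : R := 1 + tau%:R * r.
Hypotheses (gamma0 : 0 < gamma) (L0 : 0 < L) (mu0 : 0 <= mu) (r0 : 0 <= r).
Hypotheses (A0 : forall t, 0 <= A t) (G0 : forall t, 0 <= G t).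
Hypotheses (e0 : forall t, 0 <= e t) (B00 : 0 <= B0).
Hypothesis rhomu : rho <= gamma * mu / 2.
Hypothesis Arec : forall t, A t.+1 <= (1 - gamma * mu / 2) * A t
  + gamma ^+ 2 * C1 * G t
  + gamma ^+ 2 * (r + gamma * mu * C1) * \sum_(u < t | (t - u <= tau)%N) G u
  - 2 * gamma * e t.
Hypothesis Grec : forall t, G t <= 5 * L * e t
  + 5 * L / n%:R * \sum_(u < t) q ^+ (t - u - 1 - 2 * tau) * e u
  + B0 * q ^+ (t - tau).
Hypotheses (aC1 : gamma * L * C1 <= 32^-1).
Hypotheses (amu : gamma ^+ 2 * mu * tau%:R * C1 * L <= 32^-1).

Let W T := \sum_(t < T) s ^+ t.+1 * e t.
Let V T := \sum_(t < T) s ^+ t.+1 * G t.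

(** As rho <= gamma mu / 2, the factor s = (1 - rho)^-1 at most undoes the contraction of A, so the
    terms s^t A_t telescope. *)
Lemma recursion_sum T : s ^+ T * A T + 2 * gamma * W T <= A 0 +
  gamma ^+ 2 * C1 * V T + gamma ^+ 2 * (r + gamma * mu * C1) *
  \sum_(t < T) s ^+ t.+1 * \sum_(u < t) ((t - u <= tau)%N)%:R * G u.
Proof.
elim: T => [|T IH]; first by rewrite /W /V !big_ord0 expr0 mul1r !mulr0 !addr0.
rewrite /W /V !big_ord_recr /= -/(W T) -/(V T).
have sT : 0 <= s ^+ T.+1 by rewrite exprn_ge0 // ltW.
have := ler_wpM2l sT (Arec T).
have -> : \sum_(u < T | (T - u <= tau)%N) G u = \sum_(u < T) ((T - u <= tau)%N)%:R * G u.
  by rewrite big_mkcond; apply: eq_bigr => u _; case: ifP; rewrite ?mul1r ?mul0r.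
set Z := \sum_(u < T) _ in IH *; set Y := \sum_(u < T) _.
have : s ^+ T.+1 * ((1 - gamma * mu / 2) * A T) <= s ^+ T * A T.
  rewrite exprSr -mulrA; apply: ler_wpM2l; first by rewrite exprn_ge0 // ltW.
  rewrite mulrA ler_piMl // mulrC ler_pdivrMr // mul1r.
  by rewrite lerD2l lerN2.
by move: IH; lra.
Qed.

(** [recursion_sum] bounds W by V and [Grec] bounds V by W; the step size keeps the gain of this
    loop below one, so W stays bounded, and with it each of its nonnegative terms. *)
Lemma recursion_converges : exists C : R, forall t, e t <= (1 - rho) ^+ t * C.
Proof.
have C10 : 0 <= C1 by rewrite addr_ge0 // mulr_ge0.
have W0 T : 0 <= W T.
  by apply: sumr_ge0 => t _; rewrite mulr_ge0 // exprn_ge0 // ltW.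
have V0 T : 0 <= V T.
  by apply: sumr_ge0 => t _; rewrite mulr_ge0 // exprn_ge0 // ltW.
(* 25/2 = 5 + 5 * 3/2: the present point, and the table weighted by [geometric_weight]. *)
have Vle T : V T <= 25 / 2 * L * W T + B0 * (3 / 2 * n%:R).
  have h1 : V T <= \sum_(t < T) (5 * L * (s ^+ t.+1 * e t)
     + 5 * L / n%:R * (s ^+ t.+1 * \sum_(u < t) q ^+ (t - u - 1 - 2 * tau) * e u)
     + B0 * (s ^+ t.+1 * q ^+ (t - 2 * tau))).
    apply: ler_sum => t _.
    have sT : 0 <= s ^+ t.+1 by rewrite exprn_ge0 // ltW.
    apply: le_trans (ler_wpM2l sT (Grec t)) _.
    have : s ^+ t.+1 * (B0 * q ^+ (t - tau)) <= B0 * (s ^+ t.+1 * q ^+ (t - 2 * tau)).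
      rewrite mulrCA; apply: ler_wpM2l => //; apply: ler_wpM2l => //.
      by apply: ler_wiXn2l => //; rewrite leq_sub2l // leq_pmull.
    rewrite !mulrDr => h; apply: lerD h.
    by rewrite le_eqVlt; apply/orP; left; apply/eqP; ring.
  apply: le_trans h1 _; rewrite !big_split /= -!mulr_sumr.
  have h2 : \sum_(t < T) s ^+ t.+1 * \sum_(u < t) q ^+ (t - u - 1 - 2 * tau) * e u
      <= 3 / 2 * n%:R * W T.
    apply: (@convolution_le s (3 / 2 * n%:R) (fun k => q ^+ (k - 1 - 2 * tau))) => //.
      by move=> k; exact: exprn_ge0.
    move=> N; apply: le_trans (geometric_weight N).
    by under eq_bigr => k _ do rewrite subn1 /=.
  have h3 : 5 * L / n%:R * (\sum_(t < T) s ^+ t.+1 *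
      \sum_(u < t) q ^+ (t - u - 1 - 2 * tau) * e u) <= 15 / 2 * L * W T.
    have Ln : 0 <= 5 * L / n%:R by rewrite divr_ge0 // mulr_ge0 // ltW.
    apply: le_trans (ler_wpM2l Ln h2) _.
    rewrite le_eqVlt; apply/orP; left; apply/eqP; field.
    by rewrite pnatr_eq0 -lt0n.
  have h4 := ler_wpM2l B00 (geometric_weight T).
  rewrite -/(W T); move: h3 h4; lra.
have win T : \sum_(t < T) s ^+ t.+1 * \sum_(u < t) ((t - u <= tau)%N)%:R * G u
    <= 8 / 7 * tau%:R * V T.
  by apply: (@convolution_le s _ (fun k => ((k <= tau)%N)%:R)) => //; exact: window_weight.
pose C2 := r + gamma * mu * C1.
have C20 : 0 <= C2.
  by rewrite addr_ge0 // mulr_ge0 // mulr_ge0 // ltW.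
pose D := C1 + C2 * (8 / 7 * tau%:R).
have D0 : 0 <= D by rewrite addr_ge0 // mulr_ge0 // mulr_ge0.
(* The feedback through V uses at most 3/2 of the 2 gamma W in [recursion_sum], since 25/2 * (1 +
   16/7) / 32 < 3/2. *)
have DL : 25 / 2 * (gamma * L * D) <= 3 / 2.
  have h1 : gamma * L * (r * tau%:R) <= 32^-1.
    apply: le_trans aC1; apply: ler_wpM2l; first by rewrite mulr_ge0 // ltW.
    by rewrite /C1 mulrC lerDr.
  have h2 : gamma * L * (gamma * mu * C1 * tau%:R) <= 32^-1.
    by apply: le_trans amu; rewrite le_eqVlt; apply/orP; left; apply/eqP; ring.
  have -> : gamma * L * D = gamma * L * C1 + 8 / 7 * (gamma * L * (r * tau%:R))
     + 8 / 7 * (gamma * L * (gamma * mu * C1 * tau%:R)) by rewrite /D /C2; ring.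
  move: aC1 h1 h2; lra.
pose K := A 0 + gamma ^+ 2 * D * (B0 * (3 / 2 * n%:R)).
have Wle T : W T <= 2 / gamma * K.
  have h1 := recursion_sum T.
  have g2 : 0 <= gamma ^+ 2 by exact: sqr_ge0.
  have h2 := ler_wpM2l (mulr_ge0 g2 C20) (win T).
  have h3 := ler_wpM2l (mulr_ge0 g2 D0) (Vle T).
  have h4 : 0 <= s ^+ T * A T by rewrite mulr_ge0 // exprn_ge0 // ltW.
  have h5 : gamma * W T * (25 / 2 * (gamma * L * D)) <= gamma * W T * (3 / 2).
    by apply: ler_wpM2l => //; rewrite mulr_ge0 // ltW.
  have h6 : gamma * W T <= 2 * K.
    have e1 : gamma ^+ 2 * D * V T = gamma ^+ 2 * C1 * V T +
       gamma ^+ 2 * C2 * (8 / 7 * tau%:R * V T) by rewrite /D; ring.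
    have e2 : gamma ^+ 2 * D * (25 / 2 * L * W T + B0 * (3 / 2 * n%:R)) =
       gamma * W T * (25 / 2 * (gamma * L * D)) + gamma ^+ 2 * D * (B0 * (3 / 2 * n%:R)).
      by ring.
    rewrite /K; rewrite e1 e2 in h3; rewrite -/C2 in h1; move: h1 h2 h3 h4 h5; lra.
  by rewrite mulrAC ler_pdivlMr // mulrC.
exists (2 / gamma * K) => t.
have K0 : 0 <= 2 / gamma * K := le_trans (W0 0%N) (Wle 0%N).
have : s ^+ t.+1 * e t <= 2 / gamma * K.
  apply: le_trans (Wle t.+1); rewrite /W big_ord_recr /= lerDr.
  exact: W0.
rewrite /s exprVn ler_pdivrMl ?exprn_gt0 // => h; apply: le_trans h _.
apply: ler_wpM2r => //; rewrite exprS; apply: ler_piMl; last by rewrite gerBl.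
by apply: exprn_ge0; exact: ltW.
Qed.

End recursion.
End geometric_recursion.

(** * The step size [a_star] *)

Section step_size.
Context {R : realType}.
Variables (kappa Delta : R) (tau : nat).
Hypotheses (kappa0 : 0 < kappa) (Delta0 : 0 < Delta).
Let r := Num.sqrt Delta.
Let m := Num.min r^-1 tau%:R.
Let C1 := 1 + tau%:R * r.
Let xi := Num.sqrt (1 + (8 * kappa)^-1 * m).
Let a := a_star kappa Delta tau.

Let r0 : 0 < r. Proof. by rewrite sqrtr_gt0. Qed.
Let m0 : 0 <= m. Proof. by rewrite le_min invr_ge0 ltW /=. Qed.
Let C1_ge1 : 1 <= C1. Proof. by rewrite lerDl mulr_ge0 // ltW. Qed.
Let C10 : 0 < C1. Proof. exact: lt_le_trans C1_ge1. Qed.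
Let xi2 : xi ^+ 2 = 1 + (8 * kappa)^-1 * m.
Proof. by rewrite sqr_sqrtr // addr_ge0 // mulr_ge0 // invr_ge0 mulr_ge0 // ltW. Qed.
Let xi_ge1 : 1 <= xi.
Proof.
have x0 : 0 <= xi by exact: sqrtr_ge0.
rewrite -(ler_pXn2r (n := 2)) ?nnegrE // expr1n xi2 lerDl.
by rewrite mulr_ge0 // invr_ge0 mulr_ge0 // ltW.
Qed.
Let xi0 : 0 < xi. Proof. exact: lt_le_trans xi_ge1. Qed.
Let aE : a = (32 * C1 * xi)^-1. Proof. by []. Qed.
Let nzs := (lt0r_neq0 kappa0, lt0r_neq0 r0, lt0r_neq0 C10, lt0r_neq0 xi0).

Lemma a_star_gt0 : 0 < a.
Proof. by rewrite aE invr_gt0 !mulr_gt0. Qed.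

Lemma a_star_overlap : a * C1 <= 32^-1.
Proof.
have -> : a * C1 = 32^-1 / xi by rewrite aE; field; rewrite !nzs.
by rewrite ler_pdivrMr // ler_peMr.
Qed.

(** The square root in [a_star] is made for this: xi^2 >= m / (8 kappa), while tau <= m C1 whichever
    argument attains the minimum m. *)
Lemma a_star_overlap_strong : a ^+ 2 * kappa^-1 * tau%:R * C1 <= 32^-1.
Proof.
have tm : tau%:R <= m * C1.
  rewrite /m; case: (leP r^-1 tau%:R) => _.
    rewrite ler_pdivlMl // mulrC /C1; lra.
  by rewrite ler_peMr.
have km : m <= 8 * (kappa * xi ^+ 2).
  rewrite xi2 mulrDr mulr1.
  have -> : 8 * (kappa + kappa * ((8 * kappa)^-1 * m)) = 8 * kappa + m.
    by field; rewrite !nzs.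
  by rewrite lerDr mulr_ge0 // ltW.
have -> : a ^+ 2 * kappa^-1 * tau%:R * C1 = 32^-1 * (tau%:R / (32 * (C1 * (kappa * xi ^+ 2)))).
  by rewrite aE; field; rewrite !nzs.
have k0 : 0 < kappa * xi ^+ 2 by rewrite mulr_gt0 // exprn_gt0.
have k1 : 0 < C1 * (kappa * xi ^+ 2) by rewrite mulr_gt0.
rewrite ler_piMr // ler_pdivrMr ?mul1r; last by rewrite mulr_gt0.
apply: le_trans tm _.
apply: le_trans (ler_wpM2r (ltW C10) km) _.
by move: k1; lra.
Qed.

(** With N = max(n, kappa) the claim reads kappa C1 xi <= 3 (1 + K) N, since a / kappa = 1 / (32
    kappa C1 xi) and 96 = 32 * 3. *)
Lemma a_star_rate (n : nat) (K : R) : (0 < n)%N -> 0 < K ->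
  tau%:R < n%:R / 10 :> R ->
  tau%:R <= K * r^-1 * Num.max 1 (n%:R / kappa) ->
  (96 * (1 + K))^-1 * Num.min n%:R^-1 kappa^-1 <= a / kappa.
Proof.
move=> n0 K0 tn tK; pose N := Num.max (n%:R) kappa.
have n0' : 0 < n%:R :> R by rewrite ltr0n.
have N0 : 0 < N by rewrite lt_max n0'.
have nN : n%:R <= N by rewrite le_max lexx.
have kN : kappa <= N by rewrite le_max lexx orbT.
have tN : tau%:R <= N by move: tn nN; lra.
have NV : Num.min n%:R^-1 kappa^-1 = N^-1.
  rewrite /N; case: (leP n%:R kappa) => h.
    by rewrite min_r // lef_pV2 ?posrE.
  by rewrite min_l // lef_pV2 ?posrE // ltW.
have ktr : kappa * tau%:R * r <= K * N.
  have := ler_wpM2l (ltW (mulr_gt0 kappa0 r0)) tK.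
  have -> : kappa * r * (K * r^-1 * Num.max 1 (n%:R / kappa)) = K * N.
    have -> : N = kappa * Num.max 1 (n%:R / kappa).
      by rewrite maxr_pMr ?ltW // mulr1 mulrCA divff ?mulr1 ?nzs // maxC.
    by field; rewrite !nzs.
  by apply: le_trans; rewrite le_eqVlt; apply/orP; left; apply/eqP; ring.
(* Square both sides; every term is controlled by kappa tau r <= K N, tau <= N,
   m <= tau and r m <= 1. *)
have key : kappa * C1 * xi <= 3 * (1 + K) * N.
  rewrite -(ler_pXn2r (n := 2)) ?nnegrE //; first last.
  - by rewrite mulr_ge0 ?(ltW N0) // mulr_ge0 // addr_ge0 // ltW.
  - by rewrite !mulr_ge0 // ltW.
  rewrite exprMn xi2.
  have mt : m <= tau%:R by rewrite ge_min lexx orbT.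
  have mr : r * m <= 1.
    by rewrite -(@mulfV _ r) ?nzs // ler_pM2l // ge_min lexx.
  have -> : (kappa * C1) ^+ 2 * (1 + (8 * kappa)^-1 * m) =
      (kappa * C1) ^+ 2 + kappa * C1 ^+ 2 * m / 8 by field; rewrite !nzs.
  have c2 : C1 ^+ 2 <= 2 + 2 * (tau%:R * r) ^+ 2.
    have := sqr_ge0 (1 - tau%:R * r); rewrite /C1; lra.
  set x := kappa * tau%:R * r in ktr.
  have x0 : 0 <= x by rewrite !mulr_ge0 // ltW.
  have KN : 0 <= K * N by rewrite mulr_ge0 // ltW.
  have t1 : (kappa * C1) ^+ 2 <= 2 * N ^+ 2 + 2 * (K * N) ^+ 2.
    have := ler_wpM2l (sqr_ge0 kappa) c2.
    have e1 : kappa ^+ 2 * (2 + 2 * (tau%:R * r) ^+ 2) = 2 * kappa ^+ 2 + 2 * x ^+ 2.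
      by rewrite /x; ring.
    rewrite e1 -exprMn => h; apply: le_trans h _; apply: lerD.
      by apply: ler_wpM2l => //; rewrite ler_pXn2r // nnegrE ltW.
    by apply: ler_wpM2l => //; rewrite ler_pXn2r // nnegrE.
  have km0 : 0 <= kappa * m by rewrite mulr_ge0 // ltW.
  have t2 : kappa * C1 ^+ 2 * m <= 2 * N ^+ 2 + 2 * (K * N ^+ 2).
    have := ler_wpM2l km0 c2.
    have e1 : kappa * m * (2 + 2 * (tau%:R * r) ^+ 2) =
      2 * (kappa * m) + 2 * (x * (tau%:R * (r * m))) by rewrite /x; ring.
    rewrite e1 mulrAC => h; apply: le_trans h _; apply: lerD.
      by apply: ler_wpM2l => //; rewrite expr2; apply: ler_pM; rewrite ?(ltW kappa0) ?(le_trans mt).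
    have trm : tau%:R * (r * m) <= N by apply: le_trans tN; rewrite ler_piMr.
    have trm0 : 0 <= tau%:R * (r * m) by rewrite mulr_ge0 // mulr_ge0 // ltW.
    have -> : K * N ^+ 2 = K * N * N by rewrite expr2 mulrA.
    by apply: ler_wpM2l => //; exact: ler_pM.
  have e2 : (3 * (1 + K) * N) ^+ 2 = 9 * N ^+ 2 + 18 * (K * N ^+ 2) + 9 * (K * N) ^+ 2.
    by ring.
  rewrite e2; have N2 := sqr_ge0 N; have KN2 := mulr_ge0 (ltW K0) N2.
  have := sqr_ge0 (K * N); move: t1 t2; lra.
have p1 : 0 < 96 * (1 + K) * N by rewrite mulr_gt0 // mulr_gt0 // addr_gt0.
have p2 : 0 < 32 * C1 * xi * kappa by rewrite !mulr_gt0.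
rewrite NV -invfM aE -invfM lef_pV2 ?posrE //.
by move: key; lra.
Qed.

End step_size.

(** * Finitely-valued random variables *)

Section finite_range.
Context {T : Type}.

Definition fin_range (V : eqType) (Y : T -> V) : Prop :=
  exists s : seq V, forall w, Y w \in s.

Lemma fin_range_comp2 (U V W : eqType) (h : U -> V -> W) (Y : T -> U) (Z : T -> V) :
  fin_range Y -> fin_range Z -> fin_range (fun w => h (Y w) (Z w)).
Proof.
move=> [s1 H1] [s2 H2]; exists [seq h x y | x <- s1, y <- s2] => w.
exact: allpairs_f.
Qed.

Lemma fin_range_comp (U W : eqType) (h : U -> W) (Y : T -> U) :
  fin_range Y -> fin_range (h \o Y).
Proof. by move=> [s H]; exists (map h s) => w; apply: map_f. Qed.

Lemma fin_range_cst (V : eqType) (y : V) : fin_range (fun=> y).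
Proof. by exists [:: y] => w; rewrite inE. Qed.

Lemma fin_range_fin (V : finType) (Y : T -> V) : fin_range Y.
Proof. by exists (enum V) => w; rewrite mem_enum. Qed.

Lemma fin_range_sum (V : zmodType) (I : Type) (r : seq I) (Y : I -> T -> V) :
  (forall i, fin_range (Y i)) -> fin_range (fun w => \sum_(i <- r) Y i w).
Proof.
move=> H; elim: r => [|i r [s Hs]].
  by exists [:: 0] => w; rewrite big_nil inE.
have [s' Hs'] := fin_range_comp2 +%R (H i) (ex_intro _ s Hs).
by exists s' => w; rewrite big_cons.
Qed.

Lemma fin_range_row (R : nzRingType) d (Y : T -> 'rV[R]_d) :
  (forall v, fin_range (fun w => Y w 0 v)) -> fin_range Y.
Proof.
move=> H; rewrite (_ : Y = fun w => \sum_v Y w 0 v *: delta_mx 0 v).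
  apply: fin_range_sum => v.
  exact: (fin_range_comp (fun a : R => a *: (delta_mx 0 v : 'rV_d)) (H v)).
by apply/funext => w; exact: row_sum_delta.
Qed.

End finite_range.

Section simple_functions.
Context {T : Type} (F : set (set T)).
Hypothesis sF : sigma_algebra setT F.

(** Relative to a family F, so that one notion serves for the whole sigma-algebra and for the pasts;
    with a finite range it suffices to ask measurability of level sets. *)
Definition simple (V : eqType) (Y : T -> V) : Prop :=
  fin_range Y /\ forall y, F [set w | Y w = y].

Let F0 : F set0. Proof. by case: sF. Qed.
Let FC A : F A -> F (~` A).
Proof. by move=> FA; rewrite -setTD; case: sF => _ + _; apply. Qed.
Let FU A B : F A -> F B -> F (A `|` B).
Proof.
move=> FA FB; rewrite -bigcup2E; case: sF => _ _; apply => -[|[|k]] //=.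
Qed.
Let FI A B : F A -> F B -> F (A `&` B).
Proof.
move=> FA FB; rewrite -[_ `&` _]setCK setCI; apply: FC.
by apply: FU; exact: FC.
Qed.

(** A finite union of level sets, for arbitrary B: hence any map, such as [grad (f k)], may be
    applied to a simple variable. *)
Lemma simple_preimage (V : eqType) (Y : T -> V) (B : set V) :
  simple Y -> F [set w | B (Y w)].
Proof.
move=> [[s Hs] HF].
have -> : [set w | B (Y w)] = [set w | Y w \in [seq y <- s | `[< B y >]] ].
  apply/seteqP; split => w /=.
    by move=> Bw; rewrite mem_filter Hs andbT; apply/asboolP.
  by rewrite mem_filter => /andP[/asboolP].
elim: [seq y <- s | _] => [|y r IH].
  by rewrite (_ : [set w | _] = set0) //; apply/seteqP; split.
have -> : [set w | Y w \in y :: r] = [set w | Y w = y] `|` [set w | Y w \in r].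
  apply/seteqP; split => w /=; rewrite inE.
    by case/orP => [/eqP|]; [left|right].
  by case=> [->|->]; rewrite ?eqxx ?orbT.
exact: FU.
Qed.

Lemma simple_comp2 (U V W : eqType) (h : U -> V -> W) (Y : T -> U) (Z : T -> V) :
  simple Y -> simple Z -> simple (fun w => h (Y w) (Z w)).
Proof.
move=> sY sZ; have sYZ : simple (fun w => (Y w, Z w)).
  split; first exact: fin_range_comp2 (sY.1) (sZ.1).
  move=> [y z]; have -> : [set w | (Y w, Z w) = (y, z)] = [set w | Y w = y] `&` [set w | Z w = z].
    by apply/seteqP; split => w /= => [[-> ->]//|[-> ->]].
  by apply: FI; [exact: sY.2|exact: sZ.2].
split; first exact: fin_range_comp2 (sY.1) (sZ.1).
by move=> x; apply: (@simple_preimage _ _ [set p | h p.1 p.2 = x] sYZ).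
Qed.

Lemma simple_comp (U W : eqType) (h : U -> W) (Y : T -> U) :
  simple Y -> simple (h \o Y).
Proof.
move=> sY; split; first exact: fin_range_comp (sY.1).
by move=> x; apply: (@simple_preimage _ _ [set p | h p = x] sY).
Qed.

Lemma simple_cst (V : eqType) (y : V) : simple (fun=> y).
Proof.
split; first exact: fin_range_cst.
move=> z; have [->|yz] := eqVneq y z.
  rewrite (_ : [set _ | _] = ~` set0); first exact: FC.
  by apply/seteqP; split => w //= _ [].
by rewrite (_ : [set _ | _] = set0) //; apply/seteqP; split => w //= /eqP; rewrite (negbTE yz).
Qed.

Lemma simple_sum (V : zmodType) (I : Type) (r : seq I) (Y : I -> T -> V) :
  (forall i, simple (Y i)) -> simple (fun w => \sum_(i <- r) Y i w).
Proof.
move=> H; elim: r => [|i r IH].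
  rewrite (_ : (fun _ => _) = (fun=> 0)); first exact: simple_cst.
  by apply/funext => w; rewrite big_nil.
rewrite (_ : (fun _ => _) = (fun w => Y i w + \sum_(j <- r) Y j w)).
  exact: simple_comp2.
by apply/funext => w; rewrite big_cons.
Qed.

Lemma simple_sum_cond (V : zmodType) (I : Type) (r : seq I) (Q : pred I) (Y : I -> T -> V) :
  (forall i, simple (Y i)) -> simple (fun w => \sum_(i <- r | Q i) Y i w).
Proof.
move=> H; under eq_fun do rewrite big_mkcond; apply: simple_sum => i.
by case: (Q i); [exact: H|exact: simple_cst].
Qed.

Lemma simpleD (V : zmodType) (Y Z : T -> V) :
  simple Y -> simple Z -> simple (fun w => Y w + Z w).
Proof. exact: simple_comp2. Qed.

Lemma simpleB (V : zmodType) (Y Z : T -> V) :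
  simple Y -> simple Z -> simple (fun w => Y w - Z w).
Proof. exact: (@simple_comp2 _ _ _ (fun x y : V => x - y)). Qed.

Lemma simpleM (R : pzRingType) (Y Z : T -> R) :
  simple Y -> simple Z -> simple (fun w => Y w * Z w).
Proof. exact: simple_comp2. Qed.

Lemma simple_row (R : nzRingType) d (Y : T -> 'rV[R]_d) :
  (forall v, simple (fun w => Y w 0 v)) -> simple Y.
Proof.
move=> H; rewrite (_ : Y = fun w => \sum_v Y w 0 v *: delta_mx 0 v).
  apply: simple_sum => v.
  exact: (@simple_comp _ _ (fun a : R => a *: (delta_mx 0 v : 'rV_d)) _ (H v)).
by apply/funext => w; exact: row_sum_delta.
Qed.

End simple_functions.

Lemma simple_sub {T : Type} (F G : set (set T)) (V : eqType) (Y : T -> V) :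
  F `<=` G -> simple F Y -> simple G Y.
Proof. by move=> FG [fY mY]; split => // y; apply: FG. Qed.

(** * Expectation of simple variables *)

Section expectation.
Context {R : realType} {disp : measure_display} {T : measurableType disp}.
Variable P : probability T R.
Implicit Types Y Z : T -> R.

Definition Ex Y : R := Rintegral P setT Y.

Notation rsimple := (simple (@measurable _ T)).

Let mT : sigma_algebra setT (@measurable _ T).
Proof. exact: sigma_algebra_measurable. Qed.

Lemma simple_integrable Y : rsimple Y -> P.-integrable setT (EFin \o Y).
Proof.
move=> sY; apply: measurable_bounded_integrable => //.
- by rewrite fin_num_fun_lty.
- by move=> _ B mB; rewrite setTI; exact: (simple_preimage mT).
- have [[s Hs] _] := sY; exists (\sum_(y <- s) `|y|); split; first exact: num_real.
  move=> M hM w _ /=; apply: le_trans (ltW hM); have := Hs w.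
  elim: s {Hs hM} => // y r IH; rewrite inE big_cons => /orP[/eqP ->|/IH h].
    by rewrite lerDl sumr_ge0.
  by apply: le_trans h _; rewrite lerDr.
Qed.

Lemma ExE Y : rsimple Y -> 'E_P[Y]%E = (Ex Y)%:E.
Proof.
move=> sY; rewrite unlock /Ex /Rintegral fineK //.
exact: integrable_fin_num (simple_integrable sY).
Qed.

Lemma ExD Y Z : rsimple Y -> rsimple Z -> Ex (fun w => Y w + Z w) = Ex Y + Ex Z.
Proof. by move=> sY sZ; apply: RintegralD => //; exact: simple_integrable. Qed.

Lemma ExB Y Z : rsimple Y -> rsimple Z -> Ex (fun w => Y w - Z w) = Ex Y - Ex Z.
Proof. by move=> sY sZ; apply: RintegralB => //; exact: simple_integrable. Qed.

Lemma ExZ (a : R) Y : rsimple Y -> Ex (fun w => a * Y w) = a * Ex Y.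
Proof. by move=> sY; apply: RintegralZl => //; exact: simple_integrable. Qed.

Lemma Ex_cst (a : R) : Ex (fun=> a) = a.
Proof. 
rewrite /Ex Rintegral_cst //.
have -> : fine (P setT) = 1 by have := probability_setT P => /(congr1 fine).
by rewrite mulr1.
 Qed.

Lemma Ex_le Y Z : rsimple Y -> rsimple Z -> (forall w, Y w <= Z w) -> Ex Y <= Ex Z.
Proof. by move=> sY sZ YZ; apply: le_Rintegral => //; exact: simple_integrable. Qed.

Lemma Ex_ge0 Y : (forall w, 0 <= Y w) -> 0 <= Ex Y.
Proof. by move=> Y0; apply: Rintegral_ge0. Qed.

Lemma Ex_sum (I : Type) (r : seq I) (Y : I -> T -> R) :
  (forall i, rsimple (Y i)) -> Ex (fun w => \sum_(i <- r) Y i w) = \sum_(i <- r) Ex (Y i).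
Proof.
move=> H; elim: r => [|i r IH].
  rewrite big_nil -[RHS](Ex_cst 0); congr Ex.
  by apply/funext => w; rewrite big_nil.
rewrite big_cons -IH -ExD //; last exact: simple_sum.
by congr Ex; apply/funext => w; rewrite big_cons.
Qed.

Lemma Ex_sum_cond (I : Type) (r : seq I) (Q : pred I) (Y : I -> T -> R) :
  (forall i, rsimple (Y i)) ->
  Ex (fun w => \sum_(i <- r | Q i) Y i w) = \sum_(i <- r | Q i) Ex (Y i).
Proof.
move=> H; under eq_fun do rewrite big_mkcond.
rewrite Ex_sum => [|i]; last by case: (Q i); [exact: H|exact: simple_cst].
by rewrite [RHS]big_mkcond; apply: eq_bigr => i _; case: (Q i) => //; exact: Ex_cst.
Qed.

Lemma Ex_le_lin4 (Y Y1 Y2 Y3 Y4 : T -> R) (a1 a2 a3 a4 : R) :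
  rsimple Y -> rsimple Y1 -> rsimple Y2 -> rsimple Y3 -> rsimple Y4 ->
  (forall w, Y w <= a1 * Y1 w + a2 * Y2 w + a3 * Y3 w + a4 * Y4 w) ->
  Ex Y <= a1 * Ex Y1 + a2 * Ex Y2 + a3 * Ex Y3 + a4 * Ex Y4.
Proof.
move=> sY s1 s2 s3 s4 h.
have sZ (a : R) (Z : T -> R) : rsimple Z -> rsimple (fun w => a * Z w).
  by move=> sZ; apply: (simpleM mT) => //; exact: simple_cst.
have s12 := simpleD mT (sZ a1 _ s1) (sZ a2 _ s2).
have s123 := simpleD mT s12 (sZ a3 _ s3).
have s1234 := simpleD mT s123 (sZ a4 _ s4).
apply: le_trans (Ex_le sY s1234 h) _.
by rewrite (ExD s123 (sZ a4 _ s4)) (ExD s12 (sZ a3 _ s3)) (ExD (sZ a1 _ s1) (sZ a2 _ s2)) !ExZ.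
Qed.

Lemma simple_indic (F : set (set T)) (A : set T) : sigma_algebra setT F -> F A ->
  simple F (\1_A : T -> R).
Proof.
move=> sF FA; have [F0 FC _] := sF.
have FA' : F (~` A) by rewrite -setTD; exact: FC.
have bA : simple F (fun w => w \in A).
  split; first exact: fin_range_fin.
  case; [rewrite (_ : [set w | _] = A) //|rewrite (_ : [set w | _] = ~` A) //].
    by apply/seteqP; split => w /=; [move/set_mem|move/mem_set].
  apply/seteqP; split => w /= h; first by move/mem_set; rewrite h.
  by apply/negP => /set_mem.
exact: (simple_comp sF (fun b : bool => b%:R : R) bA).
Qed.

Lemma Ex_indic (A : set T) : measurable A -> Ex \1_A = fine (P A).
Proof. by move=> mA; rewrite /Ex /Rintegral integral_indic // setIT. Qed.

(** Y is a finite combination of indicators of its level sets, which are events of F. *)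
Lemma Ex_indep (F : set (set T)) (A : set T) (c : R) Y :
  sigma_algebra setT F -> F `<=` @measurable _ T -> measurable A ->
  (forall B, F B -> P (B `&` A) = (P B * c%:E)%E) ->
  simple F Y -> Ex (fun w => Y w * \1_A w) = c * Ex Y.
Proof.
move=> sF Fm mA indep sY; have [[s Hs] HF] := sY.
have YE w : Y w = \sum_(y <- undup s) y * \1_[set w | Y w = y] w.
  rewrite (bigD1_seq (Y w)) /= ?undup_uniq ?mem_undup // indicE mem_set //= mulr1.
  rewrite big1 ?addr0 // => y yY; rewrite indicE memNset ?mulr0 //=.
  by move=> e; rewrite e eqxx in yY.
have mY y : measurable [set w | Y w = y] by apply: Fm; exact: HF.
have -> : Ex Y = \sum_(y <- undup s) y * fine (P [set w | Y w = y]).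
  have {1}-> : Y = fun w => \sum_(y <- undup s) y * \1_[set w | Y w = y] w by exact/funext.
  have sI y : rsimple (\1_[set w | Y w = y] : T -> R) by exact: simple_indic.
  rewrite Ex_sum => [|y]; last by apply: simpleM => //; exact: simple_cst.
  by apply: eq_bigr => y _; rewrite ExZ ?Ex_indic.
have -> : (fun w => Y w * \1_A w) =
    fun w => \sum_(y <- undup s) y * \1_([set w | Y w = y] `&` A) w.
  apply/funext => w; rewrite {1}YE mulr_suml; apply: eq_bigr => y _.
  by rewrite indicI mulrA.
have sI y : rsimple (\1_([set w | Y w = y] `&` A) : T -> R).
  by apply: simple_indic => //; exact: measurableI.
rewrite Ex_sum => [|y]; last by apply: simpleM => //; exact: simple_cst.
rewrite mulr_sumr; apply: eq_bigr => y _.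
rewrite ExZ // Ex_indic; last exact: measurableI.
rewrite indep // fineM // ?fin_num_measure //.
by rewrite /=; ring.
Qed.

End expectation.

(** * Consequences of bounded overlap along one execution *)

Section path.
Context {R : realType} {n d : nat}.
Variables (f : 'I_n -> 'rV[R]_d -> R) (gamma : R) (tau : nat).
Variables (x0 : 'rV[R]_d) (alpha0 : 'I_n -> 'rV[R]_d).
Hypothesis alpha0_supp : forall i v, v \notin supp f i -> alpha0 i 0 v = 0.
Variable e : execution R n d.
Hypothesis pe : asaga_path f gamma tau x0 alpha0 e.

Let vs : valid_schedule f tau e. Proof. by case: pe. Qed.

(** The two are not concurrent, and t cannot be the earlier one: the read of u ends no later than
    that of t, so u starts before t finishes. *)
Lemma finish_lt_start u t : (u + tau < t)%N -> finish e u < start e t.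
Proof.
move=> ut; rewrite ltNge; apply/negP => h; apply: (bounded_overlap vs (t := u) (r := t)).
  by rewrite addn1.
split => //; apply: le_trans (start_read_end vs u) _.
apply: le_trans (read_end_finish vs t); apply: (after_read_labels vs).
by apply: leq_trans (ltnW ut); rewrite leq_addr.
Qed.

Lemma ahat_supp t k v : v \notin supp f k -> ahat e t k 0 v = 0.
Proof.
move=> vk; case: pe => _ _ /(_ t k v) [[_ ->]|[u [[_ _ vk' _] _ _]]].
  exact: alpha0_supp.
by rewrite vk' in vk.
Qed.

(** The direction iteration t would take had it sampled k. Unlike [direction] it is determined by
    the past of t, so its average over k is the conditional mean. *)
Definition direction_at t k : 'rV[R]_d :=
  grad (f k) (xhat e t) - ahat e t k
  + (n%:R^-1 *: \sum_j ahat e t j) *m (Pmx f k *m Dmx f).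

Lemma direction_supp t v : v \notin supp f (idx e t) -> direction f e t 0 v = 0.
Proof.
move=> vk; rewrite /direction mxE mulmx_PD (negbTE vk) mul0r mulr0 addr0.
by rewrite mxE [X in _ + X]mxE grad_supp // ahat_supp // subr0.
Qed.

Definition virtual t : 'rV[R]_d := x0 - gamma *: \sum_(u < t) direction f e u.

Lemma virtualS t : virtual t.+1 = virtual t - gamma *: direction f e t.
Proof. by rewrite /virtual big_ord_recr /= scalerDr opprD addrA. Qed.

(** The difference consists of the writes not yet seen. Absolute values remove the run-dependent
    choice of these writes, and by [finish_lt_start] none is older than tau. *)
Lemma xhat_virtual_le t v : 0 <= gamma ->
  `|(xhat e t - virtual t) 0 v|
  <= gamma * \sum_(u < t | (t - u <= tau)%N) `|direction f e u 0 v|.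
Proof.
move=> g0; case: pe => _ /(_ t v) rx _.
pose c (u : nat) := (v \in supp f (idx e u)) && (xwrite e u v < xread e t v).
have -> : (xhat e t - virtual t) 0 v =
    gamma * \sum_(u < t | ~~ c u) direction f e u 0 v.
  rewrite mxE rx /virtual !mxE summxE -mulr_sumr -/(c _).
  have -> : \sum_(u < t) direction f e u 0 v = \sum_(u < t | c u) direction f e u 0 v +
     \sum_(u < t | ~~ c u) direction f e u 0 v by rewrite (bigID (fun u : 'I_t => c u)).
  by ring.
rewrite normrM ger0_norm //; apply: ler_wpM2l => //.
apply: le_trans (ler_norm_sum _ _ _) _.
rewrite big_mkcond [X in _ <= X]big_mkcond; apply: ler_sum => u _.
case: ifP => [cu|_]; last by case: ifP.
case: ifP => // /negbT; rewrite -ltnNge => tu.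
have ut : (u + tau < t)%N by lia.
have [vk|vk] := boolP (v \in supp f (idx e u)); last first.
  by rewrite direction_supp // normr0.
move: cu; rewrite /c vk /= => /negP[].
have /andP[_ h1] := xwrite_after_read vs vk.
have /andP[h2 _] := xread_during_read vs t v.
exact: le_lt_trans h1 (lt_le_trans (finish_lt_start ut) h2).
Qed.

(** A product of indicators, so that expectations can be taken one factor at a time. *)
Definition avoid (k : 'I_n) (a b : nat) : R := \prod_(a <= w < b) (idx e w != k)%:R.

Lemma avoid_ge0 k a b : 0 <= avoid k a b.
Proof. by apply: prodr_ge0. Qed.

Lemma avoid_eq1 k a b : (forall w, (a <= w < b)%N -> idx e w <> k) -> avoid k a b = 1.
Proof.
move=> h; rewrite /avoid big_nat_cond big1 // => w; rewrite andbT => /h /eqP.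
by case: eqP.
Qed.

(** On the support, each coordinate comes from one write or from [alpha0], the source varying with
    the coordinate. Its weight is 1: a later sampling of k in the interval would have overwritten it
    before the read. The other terms are nonnegative. *)
Lemma ahat_sqr_le t k (h : 'rV[R]_d) : (forall v, v \notin supp f k -> h 0 v = 0) ->
  dot (ahat e t k - h) (ahat e t k - h) <=
  \sum_(u < t) (idx e u == k)%:R * avoid k (u + tau).+1 (t - tau) *
     dot (grad (f k) (xhat e u) - h) (grad (f k) (xhat e u) - h)
  + avoid k 0 (t - tau) * dot (alpha0 k - h) (alpha0 k - h).
Proof.
move=> hs; have av0 := avoid_ge0 k.
pose sq (x : 'rV[R]_d) v := (x 0 v - h 0 v) ^+ 2.
have dE x : dot (x - h) (x - h) = \sum_v sq x v.
  by rewrite dotxx; apply: eq_bigr => v _; rewrite !mxE.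
rewrite !dE mulr_sumr.
under [X in _ <= X + _]eq_bigr do rewrite dE mulr_sumr.
rewrite exchange_big /= -big_split /=; apply: ler_sum => v _.
have t1 (u : nat) : 0 <= (idx e u == k)%:R * avoid k (u + tau).+1 (t - tau) *
    sq (grad (f k) (xhat e u)) v by rewrite mulr_ge0 ?sqr_ge0 // mulr_ge0.
have t2 : 0 <= avoid k 0 (t - tau) * sq (alpha0 k) v by rewrite mulr_ge0 ?sqr_ge0.
have [vk|vk] := boolP (v \in supp f k); last first.
  rewrite {1}/sq ahat_supp // hs // subr0 expr0n /=.
  by rewrite addr_ge0 // sumr_ge0.
case: pe => _ _ /(_ t k v) [[nw aE]|[u [[ut iu _ wu] last aE]]].
  rewrite {1}/sq aE -/(sq _ v) avoid_eq1 ?mul1r ?lerDr ?sumr_ge0 // => w.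
  rewrite ltn_subRL => wt iw; apply: (nw w); split => //.
  - by lia.
  - have := awrite_after_read vs (t := w) (v := v); rewrite iw => /(_ vk)/andP[_ h1].
    have /andP[h2 _] := aread_during_read vs t k v.
    have h3 : (w + tau < t)%N by lia.
    exact: le_lt_trans h1 (lt_le_trans (finish_lt_start h3) h2).
rewrite (bigD1 (Ordinal ut)) //= {1}/sq aE -/(sq _ v) iu eqxx mul1r avoid_eq1.
  by rewrite mul1r -addrA lerDl addr_ge0 // sumr_ge0.
move=> w wt iw; have vw : v \in supp f (idx e w) by rewrite iw.
have /andP[aw1 aw2] := awrite_after_read vs vw.
have vu : v \in supp f (idx e u) by rewrite iu.
have /andP[_ au2] := awrite_after_read vs vu.
have : awrite e w v <= awrite e u v.
  apply: last; split => //; first by lia.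
  have /andP[h2 _] := aread_during_read vs t k v.
  have h3 : (w + tau < t)%N by lia.
  exact: le_lt_trans aw2 (lt_le_trans (finish_lt_start h3) h2).
have h3 : (u + tau < w)%N by case/andP: wt.
rewrite leNgt => /negP[]; apply: le_lt_trans au2 _.
exact: lt_le_trans (finish_lt_start h3) (le_trans (start_read_end vs w) aw1).
Qed.

End path.

(** * Conditioning a run on its past *)

Section run_measurability.
Context {R : realType} {n d : nat}.
Variables (f : 'I_n -> 'rV[R]_d -> R) (gamma : R) (tau : nat).
Variables (x0 : 'rV[R]_d) (alpha0 : 'I_n -> 'rV[R]_d).
Context {disp : measure_display} {T : measurableType disp}.
Variables (P : probability T R) (X : T -> execution R n d).
Hypothesis run : asaga_run f gamma tau x0 alpha0 P X.

Lemma idx_sumE (V : zmodType) t (H : 'I_n -> T -> V) :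
  (fun w => H (idx (X w) t) w) = (fun w => \sum_k H k w *+ (idx (X w) t == k)).
Proof.
apply/funext => w; rewrite (bigD1 (idx (X w) t)) //= eqxx mulr1n.
rewrite big1 ?addr0 // => k kt; rewrite eq_sym (negbTE kt) mulr0n //.
Qed.

Lemma fin_range_idx (V : zmodType) t (H : 'I_n -> T -> V) :
  (forall k, fin_range (H k)) -> fin_range (fun w => H (idx (X w) t) w).
Proof.
move=> h; rewrite idx_sumE; apply: fin_range_sum => k.
apply: (fin_range_comp2 (fun (x : V) (b : bool) => x *+ b) (h k)).
exact: (fin_range_fin (fun w => idx (X w) t == k)).
Qed.

(** Strong induction: values read are built from x0, alpha0 and finitely many earlier values. Time
    stamps enter only by selecting which writes are seen. *)
Lemma fin_range_memory t :
  (forall v, fin_range (fun w => xhat (X w) t 0 v)) /\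
  (forall k v, fin_range (fun w => ahat (X w) t k 0 v)).
Proof.
elim/ltn_ind: t => t IH.
have xr u : (u < t)%N -> fin_range (fun w => xhat (X w) u).
  by move=> ut; apply: fin_range_row; exact: (IH u ut).1.
have ar u k : (u < t)%N -> fin_range (fun w => ahat (X w) u k).
  by move=> ut; apply: fin_range_row; exact: (IH u ut).2.
have dr u : (u < t)%N -> fin_range (fun w => direction f (X w) u).
  move=> ut; apply: (@fin_range_idx _ u (fun k w => direction_at f (X w) u k)) => k.
  apply: (fin_range_comp2 +%R).
    apply: (fin_range_comp2 (fun x y : 'rV[R]_d => x - y)) (ar _ _ ut).
    exact: (fin_range_comp (grad (f k)) (xr _ ut)).
  apply: (fin_range_comp (fun x : 'rV[R]_d => (n%:R^-1 *: x) *m (Pmx f k *m Dmx f))).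
  by apply: fin_range_sum => j; exact: ar.
split=> [v|k v].
  have -> : (fun w => xhat (X w) t 0 v) = fun w => x0 0 v - \sum_(u < t)
     (gamma * direction f (X w) u 0 v) *+
       ((v \in supp f (idx (X w) u)) && (xwrite (X w) u v < xread (X w) t v)).
    apply/funext => w; case: (run_path run w) => _ -> _; congr (_ - _).
    by rewrite big_mkcond; apply: eq_bigr => u _; case: ifP.
  apply: (fin_range_comp (fun x => x0 0 v - x)); apply: fin_range_sum => u.
  apply: (fin_range_comp2 (fun (x : R) (b : bool) => x *+ b)); last first.
    exact: (fin_range_fin (fun w => (v \in supp f (idx (X w) u)) &&
                                  (xwrite (X w) u v < xread (X w) t v))).
  exact: (fin_range_comp (fun x : 'rV[R]_d => gamma * x 0 v) (dr u (ltn_ord u))).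
(* One list for all u < t, because the iteration whose write is read depends on the outcome. *)
have [s hs] : exists s : seq R, forall u w, (u < t)%N -> grad (f k) (xhat (X w) u) 0 v \in s.
  have : forall m, (m <= t)%N -> exists s : seq R,
      forall u w, (u < m)%N -> grad (f k) (xhat (X w) u) 0 v \in s.
    elim=> [|m IHm] mt; first by exists [::].
    have [s hs] := IHm (ltnW mt).
    have [s' hs'] := fin_range_comp (fun x => grad (f k) x 0 v) (xr m mt).
    exists (s ++ s') => u w; rewrite ltnS leq_eqVlt mem_cat => /orP[/eqP ->|/hs ->//].
    by apply/orP; right; exact: (hs' w).
  exact.
exists (alpha0 k 0 v :: s) => w; case: (run_path run w) => _ _ /(_ t k v).
case=> [[_ ->]|[u [[ut _ _ _] _ ->]]]; rewrite inE ?eqxx //.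
by rewrite hs ?orbT.
Qed.

Notation Fp t := (<<s past X t >>).

Lemma past_sigma t : sigma_algebra setT (Fp t).
Proof. exact: smallest_sigma_algebra. Qed.

Lemma past_mono t t' : (t <= t')%N -> Fp t `<=` Fp t'.
Proof.
move=> tt'; apply: sub_sigma_algebra2 => A [[|]|].
- move=> [u [v [B [ut mB ->]]]]; left; left.
  by exists u, v, B; split => //; exact: leq_trans ut tt'.
- move=> [u [k [v [B [ut mB ->]]]]]; left; right.
  by exists u, k, v, B; split => //; exact: leq_trans ut tt'.
- move=> [u [k [ut ->]]]; right; exists u, k; split => //; exact: leq_trans ut tt'.
Qed.

Lemma past_measurable t : Fp t `<=` @measurable _ T.
Proof.
rewrite -(sigma_algebra_id (@sigma_algebra_measurable _ T)).
apply: sub_sigma_algebra2 => A [[|]|].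
- move=> [u [v [B [ut mB ->]]]].
  have := run_xhat_measurable run u v measurableT mB.
  by rewrite setTI.
- move=> [u [k [v [B [ut mB ->]]]]].
  have := run_ahat_measurable run u k v measurableT mB.
  by rewrite setTI.
- move=> [u [k [ut ->]]]; exact: (run_idx_measurable run).
Qed.

Lemma simple_xhat t u : (u <= t)%N -> simple (Fp t) (fun w => xhat (X w) u).
Proof.
move=> ut; apply: (simple_row (past_sigma t)) => v; split; first exact: (fin_range_memory u).1.
move=> y; apply: sub_sigma_algebra; left; left.
by exists u, v, [set y]; split => //; exact: measurable_set1.
Qed.

Lemma simple_ahat t u k : (u <= t)%N -> simple (Fp t) (fun w => ahat (X w) u k).
Proof.
move=> ut; apply: (simple_row (past_sigma t)) => v; split; first exact: (fin_range_memory u).2.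
move=> y; apply: sub_sigma_algebra; left; right.
by exists u, k, v, [set y]; split => //; exact: measurable_set1.
Qed.

Lemma simple_idx t u : (u < t)%N -> simple (Fp t) (fun w => idx (X w) u).
Proof.
move=> ut; split; first exact: fin_range_fin.
by move=> k; apply: sub_sigma_algebra; right; exists u, k.
Qed.

Lemma simple_at_idx (V : zmodType) t u (H : 'I_n -> T -> V) : (u < t)%N ->
  (forall k, simple (Fp t) (H k)) -> simple (Fp t) (fun w => H (idx (X w) u) w).
Proof.
move=> ut h; have sF := past_sigma t; rewrite idx_sumE.
apply: (simple_sum sF) => k.
apply: (@simple_comp2 _ _ sF _ _ _ (fun (x : V) (i : 'I_n) => x *+ (i == k))) => //.
exact: simple_idx.
Qed.

Lemma simple_direction_at t u k : (u <= t)%N ->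
  simple (Fp t) (fun w => direction_at f (X w) u k).
Proof.
move=> ut; have sF := past_sigma t; apply: (simpleD sF).
  apply: (simpleB sF); last exact: simple_ahat.
  exact: (simple_comp sF (grad (f k)) (simple_xhat ut)).
apply: (simple_comp sF (fun x : 'rV[R]_d => (n%:R^-1 *: x) *m (Pmx f k *m Dmx f))).
by apply: (simple_sum sF) => j; exact: simple_ahat.
Qed.

Lemma simple_direction t u : (u < t)%N -> simple (Fp t) (fun w => direction f (X w) u).
Proof.
move=> ut; apply: (simple_at_idx (H := fun k w => direction_at f (X w) u k)) => // k.
exact: simple_direction_at (ltnW ut).
Qed.

Lemma Ex_mul_idx t k Y : simple (Fp t) Y ->
  Ex P (fun w => Y w * (idx (X w) t == k)%:R) = n%:R^-1 * Ex P Y.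
Proof.
move=> sY; rewrite -(Ex_indep (A := [set w | idx (X w) t = k]) (past_sigma t) (@past_measurable t) _ _ sY).
- congr Ex; apply/funext => w; rewrite indicE; congr (_ * _%:R).
  case: eqP => [e|e]; first by rewrite mem_set.
  by rewrite memNset.
- exact: (run_idx_measurable run).
- by move=> B FB; rewrite (run_idx_independent run) // (run_idx_uniform run).
Qed.

Lemma Ex_at_idx t (Z : 'I_n -> T -> R) : (forall k, simple (Fp t) (Z k)) ->
  Ex P (fun w => Z (idx (X w) t) w) = n%:R^-1 * \sum_k Ex P (Z k).
Proof.
move=> sZ; rewrite idx_sumE Ex_sum.
  rewrite mulr_sumr; apply: eq_bigr => k _; rewrite -(Ex_mul_idx k (sZ k)).
  by congr Ex; apply/funext => w; rewrite mulr_natr.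
have sF := past_sigma t.+1.
move=> k; apply: (simple_sub (@past_measurable t.+1)).
apply: (@simple_comp2 _ _ sF _ _ _ (fun (x : R) (i : 'I_n) => x *+ (i == k))).
  exact: simple_sub (past_mono (leqnSn t)) (sZ k).
exact: simple_idx.
Qed.

Lemma simple_avoid k a b : simple (Fp b) (fun w => avoid (X w) k a b).
Proof.
elim: b => [|b IH].
  rewrite (_ : (fun _ => _) = fun=> 1); first exact: (simple_cst (past_sigma _)).
  by apply/funext => w; rewrite /avoid big_geq.
have [ab|ab] := leqP a b; last first.
  rewrite (_ : (fun _ => _) = fun=> 1); first exact: (simple_cst (past_sigma _)).
  by apply/funext => w; rewrite /avoid big_geq.
have sF := past_sigma b.+1.
rewrite (_ : (fun _ => _) = fun w => avoid (X w) k a b * (idx (X w) b != k)%:R); last first.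
  by apply/funext => w; rewrite /avoid big_nat_recr.
apply: (simpleM sF); first exact: simple_sub (past_mono (leqnSn b)) IH.
exact: (simple_comp sF (fun i => (i != k)%:R : R) (simple_idx (ltnSn b))).
Qed.

(** Peel off the last factor: 1 - [i_b = k] is independent of the past of b and has mean 1 - 1/n. *)
Lemma Ex_mul_avoid k a b Y : simple (Fp a) Y ->
  Ex P (fun w => Y w * avoid (X w) k a b) = (1 - n%:R^-1) ^+ (b - a) * Ex P Y.
Proof.
move=> sY; elim: b => [|b IH].
  rewrite sub0n expr0 mul1r; congr Ex; apply/funext => w.
  by rewrite /avoid big_geq // mulr1.
have [ab|ab] := leqP a b; last first.
  have -> : (b.+1 - a = 0)%N by apply/eqP; rewrite subn_eq0.
  rewrite expr0 mul1r; congr Ex; apply/funext => w.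
  by rewrite /avoid big_geq // mulr1.
have sF := past_sigma b.
pose Z w := Y w * avoid (X w) k a b.
have sZ : simple (Fp b) Z.
  by apply: (simpleM sF); [exact: simple_sub (past_mono ab) sY|exact: simple_avoid].
have -> : (fun w => Y w * avoid (X w) k a b.+1) =
    fun w => Z w - Z w * (idx (X w) b == k)%:R.
  apply/funext => w; rewrite /Z /avoid big_nat_recr //= mulrA.
  by case: eqP => _; rewrite ?mulr0 ?mulr1 ?subrr ?subr0.
have sZ1 := simple_sub (past_mono (leqnSn b)) sZ.
rewrite ExB; first last.
- apply: (simple_sub (@past_measurable b.+1)); apply: (simpleM (past_sigma _)) => //.
  exact: (simple_comp (past_sigma _) (fun i => (i == k)%:R : R) (simple_idx (ltnSn b))).
- exact: (simple_sub (@past_measurable b)).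
by rewrite (Ex_mul_idx k sZ) IH subSn // exprS; ring.
Qed.

End run_measurability.

(** * The Lyapunov recursion *)

Lemma mulrDr_le (R : numDomainType) (c x y z : R) : z <= c * y -> c * x + z <= c * (y + x).
Proof. by rewrite mulrDr addrC lerD2r. Qed.

(** The flag b says that the coordinate lies in the support of the newer direction y; x^2, from the
    older one, is charged only there, which is how sparsity enters. *)
Lemma young_weighted (R : realType) (b : bool) (r x y : R) : 0 < r ->
  (~~ b -> y = 0) -> `|x| * `|y| <= r / 2 * y ^+ 2 + (2 * r)^-1 * (b%:R * x ^+ 2).
Proof.
move=> r0; case: b => /= [_|->//]; last first.
  by rewrite normr0 expr0n /= !mulr0 mul0r mulr0 addr0.
rewrite mul1r -[x ^+ 2]real_normK ?num_real // -[y ^+ 2]real_normK ?num_real //.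
set a := `|x|; set c := `|y|.
have h := mulr_ge0 (ltW r0) (sqr_ge0 (c - r^-1 * a)).
have e : r * (c - r^-1 * a) ^+ 2 = 2 * (r / 2 * c ^+ 2 + (2 * r)^-1 * a ^+ 2 - a * c).
  by field; exact: lt0r_neq0.
by move: h; rewrite e; lra.
Qed.

(** Transfers the strong convexity term from xhat to the virtual iterate by |x - xstar|^2 <= 2 |xhat
    - xstar|^2 + 2 |xhat - x|^2. The summand [0 * l] matches the form of [Ex_le_lin4]. *)
Lemma strong_convexity_lag (R : realType) (mu mu' o os m D a l : R) :
  o + - m + mu / 2 * D <= os -> mu' * D <= mu * D -> mu' * a <= mu' * (2 * D + 2 * l) ->
  o - os <= 1 * m + - (mu' / 4) * a + mu' / 2 * l + 0 * l.
Proof. lra. Qed.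

Lemma vdist_rec_combine (R : realType) (g mu r k A A' E G W S M l O : R) :
  A' <= A - 2 * g * M + 2 * g ^+ 2 * O + g ^+ 2 * G ->
  g * S <= g * (1 * M + - (mu / 4) * A + mu / 2 * l + 0 * l) ->
  g * mu * l <= g * mu * (g ^+ 2 * ((1 + k * r) * W)) ->
  g ^+ 2 * O <= g ^+ 2 * (r / 2 * (W + k * G)) ->
  A' <= (1 - g * mu / 2) * A + g ^+ 2 * (1 + k * r) * G
    + g ^+ 2 * (r + g * mu * (1 + k * r)) * W - 2 * g * S.
Proof. lra. Qed.

Section run_recursion.
Context {R : realType} {n d : nat}.
Variables (f : 'I_n -> 'rV[R]_d -> R) (gamma L mu : R) (xstar : 'rV[R]_d) (tau : nat).
Variables (x0 : 'rV[R]_d) (alpha0 : 'I_n -> 'rV[R]_d).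
Context {disp : measure_display} {T : measurableType disp}.
Variables (P : probability T R) (X : T -> execution R n d).
Hypothesis n0 : (0 < n)%N.
Hypothesis d0 : (0 < d)%N.
Hypothesis cf : forall i, convex_function setT (f i).
Hypothesis df : forall i x, differentiable (f i) x.
Hypothesis Lf : forall i, elipschitz L (grad (f i)).
Hypothesis mu0 : 0 < mu.
Hypothesis scf : strongly_convex mu (objective f).
Hypothesis xmin : forall x, objective f xstar <= objective f x.
Hypothesis alpha0_supp : forall i v, v \notin supp f i -> alpha0 i 0 v = 0.
Hypothesis run : asaga_run f gamma tau x0 alpha0 P X.
Hypothesis gamma0 : 0 < gamma.

Notation Fp t := (<<s past X t >>).
Notation dir u w := (direction f (X w) u).
Notation rsimple := (simple (@measurable _ T)).

Let mF : sigma_algebra setT (@measurable _ T).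
Proof. exact: sigma_algebra_measurable. Qed.
Let nV0 : 0 < (n%:R : R)^-1. Proof. by rewrite invr_gt0 ltr0n. Qed.
Let L0 : 0 < L. Proof. exact: (lipschitz_gt0 n0 cf df Lf mu0 scf d0). Qed.

Let msub t (V : eqType) (Y : T -> V) : simple (Fp t) Y -> rsimple Y.
Proof. exact: simple_sub (past_measurable run (t := t)). Qed.

Let msx t : rsimple (fun w => xhat (X w) t).
Proof. by apply: (@msub t); exact: (simple_xhat run). Qed.

Let msd t : rsimple (fun w => dir t w).
Proof. by apply: (@msub t.+1); exact: (simple_direction run). Qed.

Let msv t : rsimple (fun w => virtual f gamma x0 (X w) t).
Proof.
apply: (simple_comp mF (fun x : 'rV[R]_d => x0 - gamma *: x)).
by apply: (simple_sum mF) => u; exact: msd.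
Qed.

Let simple_dot F (Y Z : T -> 'rV[R]_d) : sigma_algebra setT F ->
  simple F Y -> simple F Z -> simple F (fun w => dot (Y w) (Z w)).
Proof. by move=> sF; exact: (simple_comp2 sF). Qed.

Let simple_sqn F (Y : T -> 'rV[R]_d) : sigma_algebra setT F ->
  simple F Y -> simple F (fun w => dot (Y w) (Y w)).
Proof. by move=> sF sY; exact: simple_dot. Qed.

Definition gsqr t := Ex P (fun w => dot (dir t w) (dir t w)).
Definition subopt t := Ex P (fun w => objective f (xhat (X w) t) - objective f xstar).
Definition vdist t := Ex P (fun w => dot (virtual f gamma x0 (X w) t - xstar)
                                         (virtual f gamma x0 (X w) t - xstar)).
Definition overlap u t w := \sum_v `|dir u w 0 v| * `|dir t w 0 v|.

Let ms_subopt t : rsimple (fun w => objective f (xhat (X w) t) - objective f xstar).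
Proof. exact: (simple_comp mF (fun x => objective f x - objective f xstar) (msx t)). Qed.

Let ms_overlap u t : rsimple (overlap u t).
Proof.
apply: (simple_sum mF) => v.
exact: (simple_comp2 mF (fun x y : 'rV[R]_d => `|x 0 v| * `|y 0 v|) (msd u) (msd t)).
Qed.

Lemma overlapC u t w : overlap u t w = overlap t u w.
Proof. by rewrite /overlap; apply: eq_bigr => v _; exact: mulrC. Qed.

Lemma overlap_refl u : Ex P (overlap u u) = gsqr u.
Proof.
congr Ex; apply/funext => w; apply: eq_bigr => v _.
by rewrite -normrM ger0_norm // -expr2 sqr_ge0.
Qed.

Let D := sparsity f.
Let r := Num.sqrt D.
Let D0 : 0 < D. Proof. exact: (sparsity_gt0 n0 cf df mu0 scf d0). Qed.
Let r0 : 0 < r. Proof. by rewrite sqrtr_gt0. Qed.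
Let r2 : r ^+ 2 = D. Proof. by rewrite sqr_sqrtr // ltW. Qed.

Lemma gsqr_ge0 t : 0 <= gsqr t.
Proof. by apply: Ex_ge0 => w; exact: dotxx_ge0. Qed.

(* Young's inequality with weight sqrt Delta, then independence of i_t from g_u. *)
Lemma Ex_overlap_lt u t : (u < t)%N -> Ex P (overlap u t) <= r / 2 * (gsqr u + gsqr t).
Proof.
move=> ut.
pose H (k : 'I_n) w := \sum_v (v \in supp f k)%:R * dir u w 0 v ^+ 2.
have sH k : simple (Fp t) (H k).
  exact: (simple_comp (past_sigma X t)
    (fun x : 'rV[R]_d => \sum_v (v \in supp f k)%:R * x 0 v ^+ 2) (simple_direction run ut)).
have sH' : rsimple (fun w => H (idx (X w) t) w).
  apply: (@msub t.+1); apply: simple_at_idx => // k.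
  exact: simple_sub (past_mono (leqnSn t)) (sH k).
have EH : Ex P (fun w => H (idx (X w) t) w) <= D * gsqr u.
  rewrite (Ex_at_idx run sH) -Ex_sum => [|k]; last exact: msub (sH k).
  have sHs : rsimple (fun w => \sum_k H k w).
    by apply: (simple_sum mF) => k; exact: msub (sH k).
  rewrite /gsqr -(ExZ P _ sHs) -(ExZ P _ (simple_sqn mF (msd u))).
  apply: Ex_le.
  - apply: (simpleM mF); first exact: simple_cst.
    by apply: (simple_sum mF) => k; exact: msub (sH k).
  - by apply: (simpleM mF); [exact: simple_cst|exact: (simple_sqn mF (msd u))].
  move=> w; rewrite /H exchange_big dotxx !mulr_sumr; apply: ler_sum => v _.
  rewrite -mulr_suml mulrA freq_sum; apply: ler_wpM2r; first exact: sqr_ge0.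
  exact: freq_le_sparsity.
have s1 : rsimple (fun w => r / 2 * dot (dir t w) (dir t w)).
  by apply: (simpleM mF); [exact: simple_cst|exact: (simple_sqn mF (msd t))].
have s2 : rsimple (fun w => (2 * r)^-1 * H (idx (X w) t) w).
  by apply: (simpleM mF); [exact: simple_cst|].
apply: (@le_trans _ _ (Ex P (fun w => r / 2 * dot (dir t w) (dir t w)
    + (2 * r)^-1 * H (idx (X w) t) w))).
  apply: Ex_le => //; first exact: simpleD.
  move=> w; rewrite dotxx /H !mulr_sumr -big_split; apply: ler_sum => v _ /=.
  have e0 : v \notin supp f (idx (X w) t) -> dir t w 0 v = 0.
    exact: (direction_supp alpha0_supp (run_path run w)).
  have e1 := young_weighted (dir u w 0 v) r0 e0.
  exact: e1.
rewrite ExD // ExZ ?ExZ //; last exact: (simple_sqn mF (msd t)).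
rewrite -/(gsqr t).
have h : (2 * r)^-1 * Ex P (fun w => H (idx (X w) t) w) <= r / 2 * gsqr u.
  have rV : 0 <= (2 * r)^-1 by rewrite invr_ge0 mulr_ge0 // ltW.
  apply: le_trans (ler_wpM2l rV EH) _; rewrite -r2.
  by rewrite le_eqVlt; apply/orP; left; apply/eqP; field; exact: lt0r_neq0.
exact: mulrDr_le h.
Qed.

Lemma Ex_overlap_le u t : Ex P (overlap u t) <= (u == t)%:R * gsqr u + r / 2 * (gsqr u + gsqr t).
Proof.
have [ut|ut|->] := ltngtP u t.
- by rewrite mul0r add0r; exact: Ex_overlap_lt.
- rewrite mul0r add0r (addrC (gsqr u)).
  rewrite (_ : overlap u t = overlap t u); first exact: Ex_overlap_lt.
  by apply/funext => w; exact: overlapC.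
- rewrite overlap_refl mul1r lerDl mulr_ge0 ?addr_ge0 ?gsqr_ge0 //.
  by rewrite divr_ge0 // ltW.
Qed.

Lemma card_window t : \sum_(u < t | (t - u <= tau)%N) 1 <= tau%:R :> R.
Proof.
rewrite big_mkcond /= (reindex_inj rev_ord_inj) /=.
have -> : \sum_(u < t) (if (t - (t - u.+1) <= tau)%N then 1 else 0 : R) =
    (\sum_(u < t) (u < tau))%N%:R.
  rewrite natr_sum; apply: eq_bigr => u _; rewrite subKn //.
  by case: ifP.
by rewrite sum_ltn_minn ler_nat geq_minr.
Qed.

Let win t := \sum_(u < t | (t - u <= tau)%N) gsqr u.
Let win0 t : 0 <= win t. Proof. by apply: sumr_ge0 => u _; exact: gsqr_ge0. Qed.

Lemma window_overlap t :
  \sum_(u < t | (t - u <= tau)%N) Ex P (overlap u t) <= r / 2 * (win t + tau%:R * gsqr t).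
Proof.
apply: (@le_trans _ _ (\sum_(u < t | (t - u <= tau)%N) r / 2 * (gsqr u + 1 * gsqr t))).
  by apply: ler_sum => u _; rewrite mul1r; exact: Ex_overlap_lt.
rewrite -mulr_sumr big_split /= -mulr_suml; apply: ler_wpM2l.
  by rewrite divr_ge0 // ltW.
by rewrite lerD2l; apply: ler_wpM2r; [exact: gsqr_ge0|exact: card_window].
Qed.

(** The diagonal gives [win t]; otherwise each member of a pair counts at most tau times, and r/2 *
    (tau + tau) = tau r. *)
Lemma window_overlap2 t :
  \sum_(u < t | (t - u <= tau)%N) \sum_(u' < t | (t - u' <= tau)%N) Ex P (overlap u u')
  <= (1 + tau%:R * r) * win t.
Proof.
apply: (@le_trans _ _ (\sum_(u < t | (t - u <= tau)%N)
    (gsqr u + r / 2 * (tau%:R * gsqr u + win t)))).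
  apply: ler_sum => u ut.
  apply: (@le_trans _ _ (\sum_(u' < t | (t - u' <= tau)%N)
      ((u == u')%:R * gsqr u + r / 2 * (1 * gsqr u + gsqr u')))).
    by apply: ler_sum => u' _; rewrite mul1r; exact: Ex_overlap_le.
  rewrite big_split /= -mulr_suml -mulr_sumr big_split /= -mulr_suml; apply: lerD.
    rewrite ler_piMl ?gsqr_ge0 // (bigD1 u) //= eqxx big1 ?addr0 // => u' /andP[_ uu'].
    by rewrite eq_sym (negbTE uu').
  apply: ler_wpM2l; first by rewrite divr_ge0 // ltW.
  by rewrite lerD2r; apply: ler_wpM2r; [exact: gsqr_ge0|exact: card_window].
rewrite big_split /= -mulr_sumr big_split /= -mulr_sumr -/(win t).
have -> : \sum_(u < t | (t - u <= tau)%N) win t =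
  (\sum_(u < t | (t - u <= tau)%N) 1) * win t.
  by rewrite mulr_suml; apply: eq_bigr => u _; rewrite mul1r.
have h := ler_wpM2r (win0 t) (card_window t).
have h' := ler_wpM2l (ltW r0) h.
by move: h'; lra.
Qed.

(** The bound of [xhat_virtual_le], squared and summed over coordinates, is a double sum of
    overlaps. *)
Lemma lag_sqr_le t :
  Ex P (fun w => dot (xhat (X w) t - virtual f gamma x0 (X w) t)
                     (xhat (X w) t - virtual f gamma x0 (X w) t))
  <= gamma ^+ 2 * ((1 + tau%:R * r) * win t).
Proof.
have s1 u : rsimple (fun w => \sum_(u' < t | (t - u' <= tau)%N) overlap u u' w).
  by apply: (simple_sum_cond mF) => u'; exact: ms_overlap.
have s2 : rsimple (fun w => \sum_(u < t | (t - u <= tau)%N)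
      \sum_(u' < t | (t - u' <= tau)%N) overlap u u' w).
  by apply: (simple_sum_cond mF) => u; exact: s1.
apply: (@le_trans _ _ (Ex P (fun w => gamma ^+ 2 * \sum_(u < t | (t - u <= tau)%N)
      \sum_(u' < t | (t - u' <= tau)%N) overlap u u' w))).
  apply: Ex_le.
  - exact: (simple_sqn mF (simpleB mF (msx t) (msv t))).
  - by apply: (simpleM mF) => //; exact: simple_cst.
  move=> w; rewrite dotxx.
  have -> : \sum_(u < t | (t - u <= tau)%N) \sum_(u' < t | (t - u' <= tau)%N) overlap u u' w
    = \sum_v (\sum_(u < t | (t - u <= tau)%N) `|dir u w 0 v|) ^+ 2.
    under eq_bigr do rewrite /overlap exchange_big.
    rewrite exchange_big; apply: eq_bigr => v _; rewrite expr2 mulr_suml.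
    by apply: eq_bigr => u _; rewrite mulr_sumr.
  rewrite mulr_sumr; apply: ler_sum => v _.
  rewrite -[X in X <= _]real_normK ?num_real // -exprMn.
  have := xhat_virtual_le alpha0_supp (run_path run w) t v (ltW gamma0).
  move=> h; rewrite ler_pXn2r // nnegrE; exact: le_trans h.
rewrite ExZ //; apply: ler_wpM2l; first exact: sqr_ge0.
apply: le_trans (window_overlap2 t).
rewrite le_eqVlt; apply/orP; left; apply/eqP.
rewrite Ex_sum_cond //; apply: eq_bigr => u _; rewrite Ex_sum_cond //.
Qed.

(** xhat_t and the table belong to the past of i_t, so the index can be averaged out, and
    [mean_mulmx_PD] cancels the table. *)
Lemma Ex_dot_direction t :
  Ex P (fun w => dot (xhat (X w) t - xstar) (dir t w)) =
  Ex P (fun w => dot (xhat (X w) t - xstar) (mean_grad f (xhat (X w) t))).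
Proof.
have sF := past_sigma X t.
have sZ k : simple (Fp t) (fun w => dot (xhat (X w) t - xstar) (direction_at f (X w) t k)).
  apply: simple_dot => //; last exact: (simple_direction_at run).
  exact: (simple_comp sF (fun x => x - xstar) (simple_xhat run (leqnn t))).
rewrite (Ex_at_idx run sZ) -Ex_sum => [|k]; last exact: msub (sZ k).
rewrite -ExZ; last by apply: (simple_sum mF) => k; exact: msub (sZ k).
congr Ex; apply/funext => w.
under eq_bigr do rewrite dotC.
rewrite -dot_suml -dotZl dotC; congr dot.
rewrite /direction_at /mean_grad big_split /= sumrB !scalerDr.
rewrite (mean_mulmx_PD n0 (b := fun k => ahat (X w) t k)).
  by rewrite scalerN subrK.
by move=> k v; exact: (ahat_supp alpha0_supp (run_path run w)).
Qed.

(** Split <x_t - xstar, g_t> into the part at xhat_t, handled by unbiasedness and strong convexity,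
    and the lag part, bounded by overlaps. The free modulus mu' serves the universal step size. *)
Lemma vdist_rec mu' t : 0 <= mu' -> mu' <= mu ->
  vdist t.+1 <= (1 - gamma * mu' / 2) * vdist t
  + gamma ^+ 2 * (1 + tau%:R * r) * gsqr t
  + gamma ^+ 2 * (r + gamma * mu' * (1 + tau%:R * r)) * win t
  - 2 * gamma * subopt t.
Proof.
move=> mu'0 mu'mu.
pose V w := virtual f gamma x0 (X w) t.
pose S w := dot (xhat (X w) t - xstar) (dir t w).
pose M w := dot (xhat (X w) t - xstar) (mean_grad f (xhat (X w) t)).
pose l w := dot (xhat (X w) t - V w) (xhat (X w) t - V w).
pose O w := \sum_(u < t | (t - u <= tau)%N) overlap u t w.
have sS : rsimple S.
  apply: simple_dot => //.
  exact: (simple_comp mF (fun x => x - xstar) (msx t)).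
have sM : rsimple M.
  exact: (simple_comp mF (fun x => dot (x - xstar) (mean_grad f x)) (msx t)).
have sl : rsimple l by exact: (simple_sqn mF (simpleB mF (msx t) (msv t))).
have sO : rsimple O.
  by apply: (simple_sum_cond mF) => u; exact: ms_overlap.
have sA t' : rsimple (fun w => dot (virtual f gamma x0 (X w) t' - xstar)
                                   (virtual f gamma x0 (X w) t' - xstar)).
  exact: (simple_sqn mF (simple_comp mF (fun x => x - xstar) (msv t'))).
have sg : rsimple (fun w => dot (dir t w) (dir t w)) by exact: (simple_sqn mF (msd t)).
have sZ (a : R) (Y : T -> R) : rsimple Y -> rsimple (fun w => a * Y w).
  by move=> sY; apply: (simpleM mF) => //; exact: simple_cst.
have EO : Ex P O = \sum_(u < t | (t - u <= tau)%N) Ex P (overlap u t).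
  by rewrite /O Ex_sum_cond.
have step1 : vdist t.+1 <= vdist t - 2 * gamma * Ex P S + 2 * gamma ^+ 2 * Ex P O
    + gamma ^+ 2 * gsqr t.
  rewrite /vdist /gsqr.
  have -> : forall a b c e : R, a - 2 * gamma * b + 2 * gamma ^+ 2 * c + gamma ^+ 2 * e =
    1 * a + (- (2 * gamma)) * b + 2 * gamma ^+ 2 * c + gamma ^+ 2 * e by move=> *; ring.
  apply: Ex_le_lin4 => //.
  move=> w; rewrite virtualS -/(V w).
  have h : dot (xhat (X w) t - V w) (dir t w) <= gamma * O w.
    rewrite /O /overlap exchange_big /= mulr_sumr; apply: ler_sum => v _.
    rewrite -mulr_suml mulrA; apply: le_trans (ler_norm _) _; rewrite normrM.
    apply: ler_wpM2r => //.
    exact: (xhat_virtual_le alpha0_supp (run_path run w) t v (ltW gamma0)).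
  have vid (x v g s : 'rV[R]_d) : dot (v - gamma *: g - s) (v - gamma *: g - s) =
      dot (v - s) (v - s) - 2 * gamma * dot (x - s) g + 2 * gamma * dot (x - v) g
      + gamma ^+ 2 * dot g g.
    by rewrite !dotE (dotC s v) (dotC g v) (dotC g s); ring.
  rewrite (vid (xhat (X w) t)) -/(S w).
  have := ler_wpM2l (ltW gamma0) h; lra.
have step2 : subopt t <= 1 * Ex P M + - (mu' / 4) * vdist t + mu' / 2 * Ex P l + 0 * Ex P l.
  rewrite /subopt /vdist; apply: Ex_le_lin4 => //.
  move=> w; rewrite -/(V w).
  have h1 := objective_strong_grad_le n0 cf df mu0 scf (xhat (X w) t) xstar.
  have h2 := dot_sub_le (xhat (X w) t - xstar) (xhat (X w) t - V w).
  have e1 : xhat (X w) t - xstar - (xhat (X w) t - V w) = V w - xstar.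
    by rewrite opprB addrC addrA subrK.
  rewrite e1 in h2.
  have e2 : dot (xstar - xhat (X w) t) (xstar - xhat (X w) t) =
     dot (xhat (X w) t - xstar) (xhat (X w) t - xstar).
    by rewrite -opprB dotNl dotNr opprK.
  have e3 : dot (mean_grad f (xhat (X w) t)) (xstar - xhat (X w) t) = - M w.
    by rewrite -opprB dotNr dotC.
  rewrite e2 e3 in h1; rewrite -/(l w) in h2.
  have h3 := ler_wpM2r (dotxx_ge0 (xhat (X w) t - xstar)) mu'mu.
  have h4 := ler_wpM2l mu'0 h2.
  exact: strong_convexity_lag h1 h3 h4.
have step3 := lag_sqr_le t; rewrite -/l in step3.
have step4 := window_overlap t; rewrite -EO in step4.
rewrite Ex_dot_direction -/M in step1.
have h2 := ler_wpM2l (ltW gamma0) step2.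
have h3 := ler_wpM2l (mulr_ge0 (ltW gamma0) mu'0) step3.
have h4 := ler_wpM2l (sqr_ge0 gamma) step4.
exact: vdist_rec_combine step1 h2 h3 h4.
Qed.

Definition gradient_table_error t := Ex P (fun w => n%:R^-1 *
  \sum_k dot (ahat (X w) t k - grad (f k) xstar) (ahat (X w) t k - grad (f k) xstar)).

Let ms_table t k : rsimple (fun w => dot (ahat (X w) t k - grad (f k) xstar)
                                         (ahat (X w) t k - grad (f k) xstar)).
Proof.
apply: simple_sqn => //; apply: (@msub t).
exact: (simple_comp (past_sigma X t) (fun x => x - grad (f k) xstar) (simple_ahat run k (leqnn t))).
Qed.

(** For index k, g = (f_k'(xhat) - f_k'(xstar)) - (b_k - mean(b) D_k) with b the table error, whose
    mean is that of the table as the mean gradient vanishes at xstar. Squaring costs a factor 2, and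
    [variance_PD_le] removes mean(b). *)
Lemma gsqr_le t : gsqr t <= 5 * L * subopt t + 2 * gradient_table_error t.
Proof.
have sF := past_sigma X t.
have sZ k : simple (Fp t) (fun w => dot (direction_at f (X w) t k) (direction_at f (X w) t k)).
  by apply: simple_sqn => //; exact: (simple_direction_at run).
have sT : rsimple (fun w => n%:R^-1 *
  \sum_k dot (ahat (X w) t k - grad (f k) xstar) (ahat (X w) t k - grad (f k) xstar)).
  apply: (simpleM mF); first exact: simple_cst.
  by apply: (simple_sum mF) => k; exact: ms_table.
rewrite /gsqr (Ex_at_idx run sZ) -Ex_sum => [|k]; last exact: msub (sZ k).
have sS : rsimple (fun w => \sum_k dot (direction_at f (X w) t k) (direction_at f (X w) t k)).
  by apply: (simple_sum mF) => k; exact: msub (sZ k).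
have sC (a : R) (Y : T -> R) : rsimple Y -> rsimple (fun w => a * Y w).
  by move=> sY; apply: (simpleM mF) => //; exact: simple_cst.
rewrite /subopt /gradient_table_error -!ExZ // -ExD; [|exact: sC|exact: sC].
apply: Ex_le; [exact: sC|by apply: (simpleD mF); exact: sC|move=> w].
pose b k := ahat (X w) t k - grad (f k) xstar.
have bs k v : v \notin supp f k -> b k 0 v = 0.
  move=> vk; rewrite /b mxE [X in _ + X]mxE grad_supp // subr0.
  exact: (ahat_supp alpha0_supp (run_path run w)).
have mb : n%:R^-1 *: \sum_k b k = n%:R^-1 *: \sum_k ahat (X w) t k.
  have := mean_grad_min n0 cf df Lf mu0 scf d0 xmin; rewrite /mean_grad => h.
  by rewrite sumrB scalerBr h subr0.
have h1 := variance_PD_le n0 bs.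
have h2 := mean_grad_diff_sqr_le n0 cf df Lf mu0 scf d0 xmin (xhat (X w) t).
rewrite mb in h1.
apply: (@le_trans _ _ (2 * (n%:R^-1 * \sum_k dot (grad (f k) (xhat (X w) t) - grad (f k) xstar)
    (grad (f k) (xhat (X w) t) - grad (f k) xstar)) +
  2 * (n%:R^-1 * \sum_k
   dot (b k - (n%:R^-1 *: \sum_k ahat (X w) t k) *m (Pmx f k *m Dmx f))
    (b k - (n%:R^-1 *: \sum_k ahat (X w) t k) *m (Pmx f k *m Dmx f))))); last first.
  by move: h1 h2; rewrite /b; lra.
have lin (a A B : R) : 2 * (a * A) + 2 * (a * B) = a * (2 * A + 2 * B) by ring.
rewrite lin; apply: ler_wpM2l; first exact: ltW.
rewrite !mulr_sumr -big_split /=; apply: ler_sum => k _.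
apply: le_trans (dot_sub_le _ _); rewrite le_eqVlt; apply/orP; left; apply/eqP.
have -> : direction_at f (X w) t k = grad (f k) (xhat (X w) t) - grad (f k) xstar -
  (b k - (n%:R^-1 *: \sum_j ahat (X w) t j) *m (Pmx f k *m Dmx f)).
  have vid (g a s m : 'rV[R]_d) : g - a + m = g - s - (a - s - m).
    by apply/rowP => v; rewrite !mxE; ring.
  exact: vid.
by [].
Qed.

(** Expectation of [ahat_sqr_le]: sampling i_u = k brings a factor 1/n, and each of the t - u - 1 -
    2 tau avoidances that follow a factor 1 - 1/n. *)
Lemma gradient_table_error_le t : gradient_table_error t <=
  5 / 2 * L / n%:R * \sum_(u < t) (1 - n%:R^-1) ^+ (t - u - 1 - 2 * tau) * subopt u
  + (n%:R^-1 * \sum_k dot (alpha0 k - grad (f k) xstar) (alpha0 k - grad (f k) xstar))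
    * (1 - n%:R^-1) ^+ (t - tau).
Proof.
pose gs k := grad (f k) xstar.
pose E k u w := dot (grad (f k) (xhat (X w) u) - gs k) (grad (f k) (xhat (X w) u) - gs k).
pose q : R := 1 - n%:R^-1.
have sE k u t' : (u <= t')%N -> simple (Fp t') (E k u).
  move=> ut; exact: (simple_comp (past_sigma X t')
   (fun x => dot (grad (f k) x - gs k) (grad (f k) x - gs k)) (simple_xhat run ut)).
have msE k u : rsimple (E k u) by apply: (@msub u); exact: sE.
have sI k (u : nat) : simple (Fp (u + tau).+1) (fun w => (idx (X w) u == k)%:R * E k u w).
  apply: (simpleM (past_sigma X _)); last by apply: sE; rewrite -addnS leq_addr.
  apply: (simple_comp (past_sigma X _) (fun i => (i == k)%:R : R)).
  by apply: simple_idx; rewrite ltnS leq_addr.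
have sC (a : R) (Y : T -> R) : rsimple Y -> rsimple (fun w => a * Y w).
  by move=> sY; apply: (simpleM mF) => //; exact: simple_cst.
have msA k a b : rsimple (fun w => avoid (X w) k a b) by apply: (@msub b); exact: simple_avoid.
have key k : Ex P (fun w => dot (ahat (X w) t k - gs k) (ahat (X w) t k - gs k)) <=
    \sum_(u < t) q ^+ (t - u - 1 - 2 * tau) * (n%:R^-1 * Ex P (E k u))
    + q ^+ (t - tau) * dot (alpha0 k - gs k) (alpha0 k - gs k).
  have sB u : rsimple (fun w => (idx (X w) u == k)%:R * E k u w * avoid (X w) k (u + tau).+1 (t - tau)).
    by apply: (simpleM mF) => //; exact: msub (sI k u).
  have sB0 : rsimple (fun w => dot (alpha0 k - gs k) (alpha0 k - gs k) * avoid (X w) k 0 (t - tau)).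
    exact: sC.
  apply: (@le_trans _ _ (Ex P (fun w =>
     \sum_(u < t) (idx (X w) u == k)%:R * E k u w * avoid (X w) k (u + tau).+1 (t - tau)
     + dot (alpha0 k - gs k) (alpha0 k - gs k) * avoid (X w) k 0 (t - tau)))).
    apply: Ex_le; first exact: ms_table.
      by apply: (simpleD mF) => //; exact: (simple_sum mF).
    move=> w; have hs v : v \notin supp f k -> gs k 0 v = 0 by exact: grad_supp.
    apply: le_trans (ahat_sqr_le alpha0_supp (run_path run w) t hs) _.
    rewrite le_eqVlt; apply/orP; left; apply/eqP; congr (_ + _); last exact: mulrC.
    by apply: eq_bigr => u _; rewrite mulrAC.
  rewrite ExD //; last exact: (simple_sum mF).
  rewrite Ex_sum //; apply: lerD.
    apply: ler_sum => u _; rewrite (Ex_mul_avoid run k (t - tau) (sI k u)).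
    rewrite -/q (_ : (t - tau - (u + tau).+1 = t - u - 1 - 2 * tau)%N); last by lia.
    rewrite -(Ex_mul_idx run k (sE k u u (leqnn u))).
    by rewrite le_eqVlt; apply/orP; left; apply/eqP; congr (_ * Ex _ _); apply/funext => w; exact: mulrC.
  rewrite (Ex_mul_avoid run k (t - tau) (simple_cst (past_sigma X 0) (dot (alpha0 k - gs k) (alpha0 k - gs k)))).
  by rewrite subn0 Ex_cst.
rewrite /gradient_table_error ExZ; last by apply: (simple_sum mF) => k; exact: ms_table.
rewrite Ex_sum; last by move=> k; exact: ms_table.
apply: (@le_trans _ _ (n%:R^-1 * \sum_k
    (\sum_(u < t) q ^+ (t - u - 1 - 2 * tau) * (n%:R^-1 * Ex P (E k u))
    + q ^+ (t - tau) * dot (alpha0 k - gs k) (alpha0 k - gs k)))).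
  apply: ler_wpM2l; first exact: ltW.
  by apply: ler_sum => k _; exact: key.
rewrite big_split /= mulrDr -mulr_sumr exchange_big /=; apply: lerD; last first.
  by rewrite le_eqVlt; apply/orP; left; apply/eqP; rewrite mulrCA mulrC.
rewrite !mulr_sumr; apply: ler_sum => u _.
rewrite -!mulr_sumr -Ex_sum //.
have h : n%:R^-1 * Ex P (fun w => \sum_k E k u w) <= 5 / 2 * L * subopt u.
  rewrite -!ExZ //; last exact: (simple_sum mF).
  apply: Ex_le; [by apply: sC; exact: (simple_sum mF)|exact: sC|move=> w].
  exact: (mean_grad_diff_sqr_le n0 cf df Lf mu0 scf d0 xmin (xhat (X w) u)).
have qn : 0 <= n%:R^-1 * q ^+ (t - u - 1 - 2 * tau).
  rewrite mulr_ge0 ?(ltW nV0) // exprn_ge0 // subr_ge0 invf_le1 ?ler1n // ltr0n //.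
have := ler_wpM2l qn h; set S := Ex P _; set Q := q ^+ _.
by rewrite -/q -/Q; lra.
Qed.

Lemma subopt_converges mu' rho : 0 <= mu' -> mu' <= mu ->
  tau%:R < n%:R / 10 :> R -> 0 <= rho -> rho <= (10 * n%:R)^-1 ->
  rho <= gamma * mu' / 2 ->
  gamma * L * (1 + tau%:R * r) <= 32^-1 ->
  gamma ^+ 2 * mu' * tau%:R * (1 + tau%:R * r) * L <= 32^-1 ->
  exists C : R, forall t, subopt t <= (1 - rho) ^+ t * C.
Proof.
move=> mu'0 mu'mu tn rho0 rhon rhom h1 h2.
pose B0 := 2 * (n%:R^-1 * \sum_k dot (alpha0 k - grad (f k) xstar) (alpha0 k - grad (f k) xstar)).
apply: (@recursion_converges R n tau rho n0 tn rho0 rhon vdist gsqr subopt gamma L mu' r B0) => //.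
- exact: ltW.
- by move=> t; apply: Ex_ge0 => w; exact: dotxx_ge0.
- exact: gsqr_ge0.
- by move=> t; apply: Ex_ge0 => w; rewrite subr_ge0.
- rewrite mulr_ge0 // mulr_ge0 ?(ltW nV0) // sumr_ge0 // => k _; exact: dotxx_ge0.
- by move=> t; exact: vdist_rec.
- move=> t; have := gsqr_le t; have := gradient_table_error_le t; rewrite /B0.
  set S := \sum_(u < t) _; set q := _ ^+ (t - tau); lra.
Qed.

End run_recursion.

(** * The two choices of step size *)

Lemma run_converges (R : realType) (n d : nat) (f : 'I_n -> 'rV[R]_d -> R)
    (gamma L mu mu' rho : R) (xstar : 'rV[R]_d) (tau : nat) :
  (0 < n)%N -> (0 < d)%N ->
  (forall i, convex_function setT (f i)) ->
  (forall i x, differentiable (f i) x) ->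
  (forall i, elipschitz L (grad (f i))) ->
  0 < mu -> strongly_convex mu (objective f) ->
  (forall x, objective f xstar <= objective f x) ->
  0 < gamma -> 0 <= mu' -> mu' <= mu -> tau%:R < n%:R / 10 :> R ->
  0 <= rho -> rho <= (10 * n%:R)^-1 -> rho <= gamma * mu' / 2 ->
  gamma * L * (1 + tau%:R * Num.sqrt (sparsity f)) <= 32^-1 ->
  gamma ^+ 2 * mu' * tau%:R * (1 + tau%:R * Num.sqrt (sparsity f)) * L <= 32^-1 ->
  asaga_converges f xstar tau gamma rho.
Proof.
move=> n0 d0 cf df Lf mu0 scf xmin g0 mu'0 mu'mu tn rho0 rhon rhom h1 h2.
move=> x0 alpha0 alpha0_supp disp T P X run.
have [C HC] := subopt_converges n0 d0 cf df Lf mu0 scf xmin alpha0_supp run g0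
  mu'0 mu'mu tn rho0 rhon rhom h1 h2.
exists C => t; have mF := @sigma_algebra_measurable _ T.
have sx : simple (@measurable _ T) (fun w => xhat (X w) t).
  exact: simple_sub (past_measurable run (t := t)) (simple_xhat run (leqnn t)).
have so := simple_comp mF (objective f) sx.
have := HC t; rewrite /subopt (ExB P so (simple_cst mF _)) Ex_cst => h.
by rewrite (ExE P so) -EFinB lee_fin.
Qed.

Theorem corollary9 (R : realType) (K : R) (K_gt0 : 0 < K) :
  exists c c' : R, [/\ 0 < c, 0 < c' &
    forall (n d : nat) (f : 'I_n -> 'rV[R]_d -> R) (L mu : R)
      (xstar : 'rV[R]_d) (tau : nat),
    (0 < n)%N -> (0 < d)%N ->
    (forall i, convex_function setT (f i)) ->
    (forall i x, differentiable (f i) x) ->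
    (forall i, elipschitz L (grad (f i))) ->
    0 < mu -> strongly_convex mu (objective f) ->
    (forall x, objective f xstar <= objective f x) ->
    let kappa := L / mu in
    let Delta := sparsity f in
    tau%:R < n%:R / 10 :> R ->
    tau%:R <= K * (Num.sqrt Delta)^-1 * Num.max 1 (n%:R / kappa) ->
    (exists rho : R,
      [/\ c * Num.min n%:R^-1 kappa^-1 <= rho, rho < 1 &
          asaga_converges f xstar tau (a_star kappa Delta tau / L) rho])
    /\
    (tau%:R <= K * (Num.sqrt Delta)^-1 ->
     exists rho : R,
      [/\ c * Num.min n%:R^-1 kappa^-1 <= rho, rho < 1 &
          asaga_converges f xstar tau (c' / L) rho])].
Proof.
have K1 : 0 < 1 + K by rewrite addr_gt0.
(* c' is such that tau sqrt(Delta) <= K gives c' (1 + tau sqrt(Delta)) <= 1/32. In c, 192 = 2 * 96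
   combines [a_star_rate] with the half in gamma mu / 2; the universal step would allow 64. *)
exists (192 * (1 + K))^-1, (32 * (1 + K))^-1; split.
- by rewrite invr_gt0 mulr_gt0.
- by rewrite invr_gt0 mulr_gt0.
move=> n d f L mu xstar tau n0 d0 cf df Lf mu0 scf xmin kappa Delta tn tK.
have L0 : 0 < L := lipschitz_gt0 n0 cf df Lf mu0 scf d0.
have D0 : 0 < Delta := sparsity_gt0 n0 cf df mu0 scf d0.
have k0 : 0 < kappa by rewrite divr_gt0.
have nV0 : 0 < (n%:R : R)^-1 by rewrite invr_gt0 ltr0n.
have nz : n%:R != 0 :> R by rewrite pnatr_eq0 -lt0n.
have m0 : 0 < Num.min (n%:R : R)^-1 kappa^-1 by rewrite lt_min nV0 invr_gt0.
set m := Num.min _ _ in m0 *.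
have mn : m <= n%:R^-1 by rewrite ge_min lexx.
pose r := Num.sqrt Delta.
have r0 : 0 < r by rewrite sqrtr_gt0.
have n10 : (10 * n%:R : R)^-1 < 1.
  have n1 : 1 <= n%:R :> R by rewrite ler1n.
  by rewrite invf_lt1; lra.
have n10p : 0 < (10 * n%:R : R)^-1 by rewrite invr_gt0 mulr_gt0 // ltr0n.
have c_n : (192 * (1 + K))^-1 * m <= (10 * n%:R)^-1.
  rewrite [(10 * _)^-1]invfM; apply: ler_pM => //.
  - by rewrite invr_ge0 mulr_ge0 // ltW.
  - exact: ltW.
  - by rewrite lef_pV2 ?posrE ?mulr_gt0 //; lra.
split.
- have a0 := a_star_gt0 tau k0 D0.
  have a1 := a_star_overlap tau k0 D0.
  have a2 := a_star_overlap_strong tau k0 D0.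
  have a3 := a_star_rate k0 D0 n0 K_gt0 tn tK.
  set a := a_star kappa Delta tau in a0 a1 a2 a3 *.
  have gm : a / L * mu / 2 = a / kappa / 2.
    by rewrite /kappa; field; rewrite !lt0r_neq0.
  exists (Num.min (10 * n%:R)^-1 (a / L * mu / 2)); split.
  + rewrite le_min c_n /= gm.
    have -> : (192 * (1 + K))^-1 * m = (96 * (1 + K))^-1 * m / 2.
      by field; rewrite lt0r_neq0.
    by rewrite ler_pM2r // invr_gt0.
  + by rewrite gt_min n10.
  + apply: (@run_converges _ _ _ _ _ L mu mu) => //.
    * by rewrite divr_gt0.
    * exact: ltW.
    * by rewrite ltW // lt_min n10p gm divr_gt0 // divr_gt0.
    * by rewrite ge_min lexx.
    * by rewrite ge_min lexx orbT.
    * by rewrite divfK // lt0r_neq0.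
    * apply: le_trans a2; rewrite le_eqVlt; apply/orP; left; apply/eqP.
      by rewrite /kappa; field; rewrite !lt0r_neq0.
- move=> tK'; set a := (32 * (1 + K))^-1.
  have a0 : 0 < a by rewrite invr_gt0 mulr_gt0.
  (* mu' = min(L/n, mu): this keeps the order min(1/n, 1/kappa) of the rate and makes mu' tau / L <=
     1, which frees the step size from kappa. *)
  pose mu' := m * L.
  have mu'0 : 0 < mu' by rewrite mulr_gt0.
  have mu'mu : mu' <= mu.
    rewrite /mu' -ler_pdivlMr //; apply: (@le_trans _ _ kappa^-1).
      by rewrite ge_min lexx orbT.
    by rewrite /kappa invf_div.
  have tr : tau%:R * r <= K by move: tK'; rewrite ler_pdivlMr.
  have tr0 : 0 <= tau%:R * r by rewrite mulr_ge0 // ltW.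
  have a1 : a * (1 + tau%:R * r) <= 32^-1.
    rewrite -(@mulfVK _ (1 + K) _ 32^-1) ?lt0r_neq0 //.
    rewrite /a invfM; apply: ler_wpM2l; last by rewrite lerD2l.
    by rewrite mulr_ge0 // invr_ge0 // ltW.
  have a_le1 : a <= 1.
    by rewrite invf_le1 ?mulr_gt0 //; lra.
  have mtau : m * tau%:R <= 1.
    have := ler_pM (ltW m0) (ler0n R tau) mn (ltW tn).
    rewrite mulrA mulVf // mul1r => h; apply: le_trans h _.
    by rewrite invf_le1 // ler1n.
  have gm : a / L * mu' / 2 = (64 * (1 + K))^-1 * m.
    by rewrite /a /mu'; field; rewrite !lt0r_neq0.
  exists (Num.min (10 * n%:R)^-1 (a / L * mu' / 2)); split.
  + rewrite le_min c_n /= gm ler_pM2r // lef_pV2 ?posrE ?mulr_gt0 //.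
    by move: K1; lra.
  + by rewrite gt_min n10.
  + apply: (@run_converges _ _ _ _ _ L mu mu') => //.
    * by rewrite divr_gt0.
    * exact: ltW.
    * by rewrite ltW // lt_min n10p gm mulr_gt0 // invr_gt0 mulr_gt0.
    * by rewrite ge_min lexx.
    * by rewrite ge_min lexx orbT.
    * by rewrite divfK // lt0r_neq0.
    (* The left side of the first condition times a m tau, where a <= 1 and m tau <= 1. *)
    * have -> : (a / L) ^+ 2 * mu' * tau%:R * (1 + tau%:R * Num.sqrt (sparsity f)) * L =
        a * (1 + tau%:R * r) * (a * (m * tau%:R)).
        by rewrite /mu' /r /Delta; field; rewrite !lt0r_neq0.
      apply: le_trans a1; rewrite ler_piMr //.
        by rewrite mulr_ge0 ?(ltW a0) // addr_ge0.
      have mt0 : 0 <= m * tau%:R by rewrite mulr_ge0 // ltW.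
      exact: mulr_ile1 (ltW a0) mt0 a_le1 mtau.
Qed.
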